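(* Let $F$ be a $p$-adic field and let $\phi_1,\phi_2:W_F\to\mathrm{GL}_n(\mathbb C)$ be semisimple parameters. If $$\Gamma(\tau,\phi_1)=\Gamma(\tau,\phi_2)$$ for all irreducible semisimple parameters $\tau:W_F\to\mathrm{GL}_m(\mathbb C)$ and all $m\le n$, then $\phi_1\simeq\phi_2$.
   Context: A $p$-adic field is a finite extension of $\mathbb Q_p$; $W_F$ is its Weil group, $I_F$ the inertia subgroup, $q$ the residue cardinality. A semisimple parameter $\phi:W_F\to\mathrm{GL}_n(\mathbb C)$ is a homomorphism with open kernel whose image consists of semisimple elements (i.e. a semisimple smooth representation). Its $L$-factor is $L(s,\phi)=\det(1-q^{-s}\phi(\mathrm{Fr})|_{V_\phi^{I_F}})^{-1}$, with $V_\phi$ the space of $\phi$ and $\mathrm{Fr}$ a Frobenius; its gamma factor is $\gamma(s,\phi,\psi)=\epsilon(s,\phi,\psi)L(1-s,\phi^* )/L(s,\phi)\in\mathbb C(q^{-s})$, with $\phi^*$ the dual and $\epsilon(s,\phi,\psi)$ the Deligne–Langlands epsilon factor (a monomial in $q^{-s}$) for a nontrivial additive character $\psi$. For semisimple parameters $\phi_1,\phi_2$ (of possibly different dimensions), $\Gamma(\phi_1,\phi_2)$ is the divisor of the rational function of $q^{-s}$ (with $q^{-s}$ ranging over $\mathbb C^\times$) $\gamma(s,\phi_1^*\otimes\phi_2,\psi)\,\gamma(-s,\phi_1\otimes\phi_2^*,\overline\psi)$, which equals the divisor of $$\frac{L(1-s,\phi_1\otimes\phi_2^* )\,L(1+s,\phi_1^*\otimes\phi_2)}{L(s,\phi_1^*\otimes\phi_2)\,L(-s,\phi_1\otimes\phi_2^*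 )}$$ and does not depend on $\psi$. $\phi_1\simeq\phi_2$ means isomorphic as representations. *)

(* Defs.v *)
From HB Require Import structures.
From mathcomp Require Import all_boot all_order all_algebra all_field.
From mathcomp Require Import boolp classical_sets reals.
From mathcomp Require Import complex mxtens.

Set Implicit Arguments.
Unset Strict Implicit.
Unset Printing Implicit Defensive.

Import Order.TTheory GRing.Theory Num.Theory.
Local Open Scope ring_scope.

(* Z_p is the inverse limit of the rings Z/p^n, a residue class mod p^n being
   represented by the integer of [0, p^n[ it contains.  The compatibility
   condition x n = x n.+1 %% p^n also forces this normalization. *)
Definition padic_coherent (p : nat) (x : nat -> int) : Prop :=
  forall n, (x n.+1 %% (p ^ n)%N%:Z)%Z = x n.

(* The primality proof is a parameter so that the ring structures below can be
   inferred from the type. *)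
Record padic_int (p : nat) (p_pr : prime p) := PadicInt {
  padic_res :> nat -> int;
  _ : `[< padic_coherent p padic_res >] }.

HB.instance Definition _ p p_pr := [isSub for @padic_res p p_pr].
HB.instance Definition _ p p_pr := [Choice of @padic_int p p_pr by <:].

Section PadicIntegers.
Variables (p : nat) (p_pr : prime p).
Local Notation Zp := (padic_int p_pr).
Local Notation P n := ((p ^ n)%N%:Z).

Lemma padic_resP (x : Zp) : padic_coherent p x.
Proof. by case: x => x xP; apply/asboolP. Qed.

Lemma padic_pow_neq0 n : P n != 0.
Proof. by rewrite eqz_nat -lt0n expn_gt0 prime_gt0. Qed.

Lemma padic_pow_gt0 n : 0 < P n.
Proof. by rewrite ltz_nat expn_gt0 prime_gt0. Qed.

Lemma padic_res_mod (x : Zp) n : (x n %% P n)%Z = x n.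
Proof. by rewrite -[in LHS](padic_resP x) modz_mod padic_resP. Qed.

Lemma padic_modz_modS m n : ((m %% P n.+1)%Z %% P n)%Z = (m %% P n)%Z.
Proof.
apply/eqP; rewrite eqz_mod_dvd; apply: (@dvdz_trans (P n.+1)).
  by rewrite dvdzE /= dvdn_exp2l.
by rewrite -eqz_mod_dvd modz_mod.
Qed.

(* Reduces a sequence of integers that is coherent modulo the p^n. *)
Lemma padic_redP (f : nat -> int) :
  (forall n, (f n.+1 %% P n)%Z = (f n %% P n)%Z) ->
  `[< padic_coherent p (fun n => (f n %% P n)%Z) >].
Proof. by move=> fP; apply/asboolP => n; rewrite padic_modz_modS. Qed.

Definition padic_red f fP : Zp := PadicInt p_pr (@padic_redP f fP).

Lemma padic_const_subproof (m : int) n : ((fun=> m) n.+1 %% P n)%Z = ((fun=> m) n %% P n)%Z.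
Proof. by []. Qed.
Lemma padic_opp_subproof (x : Zp) n : (- x n.+1 %% P n)%Z = (- x n %% P n)%Z.
Proof. by rewrite -modzNm padic_resP. Qed.
Lemma padic_add_subproof (x y : Zp) n :
  ((x n.+1 + y n.+1) %% P n)%Z = ((x n + y n) %% P n)%Z.
Proof. by rewrite -modzDm !padic_resP. Qed.
Lemma padic_mul_subproof (x y : Zp) n :
  ((x n.+1 * y n.+1) %% P n)%Z = ((x n * y n) %% P n)%Z.
Proof. by rewrite -modzMm !padic_resP. Qed.

Definition padic_const m : Zp := padic_red (padic_const_subproof m).
Definition padic_opp x : Zp := padic_red (padic_opp_subproof x).
Definition padic_add x y : Zp := padic_red (padic_add_subproof x y).
Definition padic_mul x y : Zp := padic_red (padic_mul_subproof x y).

Lemma padic_eqP (x y : Zp) : (forall n, x n = y n) -> x = y.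
Proof. by move=> xy; apply: val_inj; apply/funext. Qed.

Lemma padic_addA : associative padic_add.
Proof. by move=> x y z; apply: padic_eqP => n /=; rewrite modzDml modzDmr addrA. Qed.
Lemma padic_addC : commutative padic_add.
Proof. by move=> x y; apply: padic_eqP => n /=; rewrite addrC. Qed.
Lemma padic_add0 : left_id (padic_const 0) padic_add.
Proof. by move=> x; apply: padic_eqP => n /=; rewrite modzDml add0r padic_res_mod. Qed.
Lemma padic_addN : left_inverse (padic_const 0) padic_opp padic_add.
Proof. by move=> x; apply: padic_eqP => n /=; rewrite modzDml addNr. Qed.

HB.instance Definition _ :=
  GRing.isZmodule.Build Zp padic_addA padic_addC padic_add0 padic_addN.

Lemma padic_mulA : associative padic_mul.
Proof. by move=> x y z; apply: padic_eqP => n /=; rewrite modzMml modzMmr mulrA. Qed.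
Lemma padic_mulC : commutative padic_mul.
Proof. by move=> x y; apply: padic_eqP => n /=; rewrite mulrC. Qed.
Lemma padic_mul1 : left_id (padic_const 1) padic_mul.
Proof. by move=> x; apply: padic_eqP => n /=; rewrite modzMml mul1r padic_res_mod. Qed.
Lemma padic_mulDl : left_distributive padic_mul padic_add.
Proof.
by move=> x y z; apply: padic_eqP => n /=; rewrite modzMml modzDm mulrDl.
Qed.
Lemma padic_1_neq0 : padic_const 1 != 0.
Proof.
apply/eqP => /(congr1 (fun x : Zp => x 1%N)) /=.
by rewrite mod0z modz_small // expn1 ltz_nat prime_gt1.
Qed.

HB.instance Definition _ := GRing.Zmodule_isComNzRing.Build Zp
  padic_mulA padic_mulC padic_mul1 padic_mulDl padic_1_neq0.

Definition padic_unit : pred Zp := fun x => `[< exists y, y * x = 1 >].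
Definition padic_inv (x : Zp) : Zp :=
  if pselect (exists y, y * x = 1) is left e then sval (cid e) else x.

Lemma padic_mulV : {in padic_unit, left_inverse 1 padic_inv *%R}.
Proof.
move=> x /asboolP xu; rewrite /padic_inv; case: pselect => // e.
by case: (cid e).
Qed.
Lemma padic_unitP x y : y * x = 1 -> padic_unit x.
Proof. by move=> xy; apply/asboolP; exists y. Qed.
Lemma padic_inv_out : {in [predC padic_unit], padic_inv =1 id}.
Proof.
move=> x; rewrite inE => /negP xu; rewrite /padic_inv; case: pselect => // e.
by case: xu; apply/asboolP.
Qed.

HB.instance Definition _ := GRing.ComNzRing_hasMulInverse.Build Zp
  padic_mulV padic_unitP padic_inv_out.

Lemma padic_res_dvd (x : Zp) m n : (n <= m)%N -> (P n %| x m - x n)%Z.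
Proof.
elim: m => [|m IH]; first by rewrite leqn0 => /eqP->; rewrite subrr.
rewrite leq_eqVlt => /orP[/eqP->|]; first by rewrite subrr.
rewrite ltnS => le_nm; rewrite -(subrKA (x m)) rpredD ?IH //.
apply: (@dvdz_trans (P m)); first by rewrite dvdzE /= dvdn_exp2l.
by rewrite -eqz_mod_dvd padic_resP padic_res_mod.
Qed.

Lemma padic_eq0 (x : Zp) : (forall n, (P n %| x n)%Z) -> x = 0.
Proof.
move=> x0; apply: padic_eqP => n; rewrite -padic_res_mod [RHS]mod0z.
exact/dvdz_mod0P.
Qed.

Lemma padic_mulf_eq0 (x y : Zp) : x * y = 0 -> (x == 0) || (y == 0).
Proof.
move=> xy0; apply: contraT; rewrite negb_or => /andP[/eqP nx /eqP ny].
have nzP (z : Zp) : z <> 0 -> exists n, ~~ (P n %| z n)%Z.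
  move=> nz; apply: contra_notP nz => /forallNP zP.
  by apply: padic_eq0 => n; apply/negPn/negP/zP.
have [k xk] := nzP _ nx; have [l yl] := nzP _ ny.
have xk' : ~~ (P k %| x (k + l)%N)%Z.
  apply: contra xk => xk.
  by rewrite -(subrK (x (k + l)%N) (x k)) rpredD // -opprB rpredN padic_res_dvd ?leq_addr.
have yl' : ~~ (P l %| y (k + l)%N)%Z.
  apply: contra yl => yl.
  by rewrite -(subrK (y (k + l)%N) (y l)) rpredD // -opprB rpredN padic_res_dvd ?leq_addl.
have /dvdz_mod0P : ((x (k + l)%N * y (k + l)%N) %% P (k + l))%Z = 0.
  by have /(congr1 (fun z : Zp => z (k + l)%N)) /= := xy0; rewrite mod0z.
move: xk' yl'; rewrite !dvdzE abszM /=.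
set a := `|x _|%N; set b := `|y _|%N => ak bl ab.
have a0 : (0 < a)%N by case: (a) ak; rewrite ?dvdn0.
have b0 : (0 < b)%N by case: (b) bl; rewrite ?dvdn0.
move: ak bl ab; rewrite !pfactor_dvdn ?muln_gt0 ?a0 // lognM // -!ltnNge.
by move=> ak bl; rewrite leqNgt -addSn leq_add // ltnW.
Qed.

HB.instance Definition _ :=
  GRing.ComUnitRing_isIntegral.Build Zp padic_mulf_eq0.

End PadicIntegers.

Definition Qp (p : nat) (p_pr : prime p) : fieldType :=
  {fraction (padic_int p_pr)}.

Section WeilGroup.
Variables (p : nat) (p_pr : prime p) (F : fieldExtType (Qp p_pr)).
Variables (Fbar : closedFieldType) (iota : {rmorphism F -> Fbar}).

Definition algebraic_closure : Prop :=
  forall x : Fbar, algebraicOver iota x.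

Definition of_Zp (z : padic_int p_pr) : Fbar :=
  iota (in_alg F (FracField.tofrac z)).

(* The p-adic absolute value extends uniquely to Fbar.  An element x has
   |x| <= 1 iff it is integral over Z_p, and |x| < 1 iff it is integral over the
   ideal p Z_p, i.e. a root of a monic polynomial over Z_p whose other
   coefficients are divisible by p. *)
Definition int_ring : set Fbar := [set x | integralOver of_Zp x]%classic.

Definition max_ideal : set Fbar :=
  [set x | exists f : {poly padic_int p_pr},
     [/\ f \is monic,
         forall i, (i < (size f).-1)%N -> exists c, f`_i = p%:R * c &
         root (map_poly of_Zp f) x]]%classic.

(* q is the number of elements of O_F / m_F: the fibres of r over O_F are
   exactly the residue classes. *)
Definition residue_card (q : nat) : Prop :=
  exists r : F -> 'I_q,
    (forall i, exists2 x, int_ring (iota x) & r x = i) /\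
    (forall x y, int_ring (iota x) -> int_ring (iota y) ->
       r x = r y <-> max_ideal (iota (x - y))).

Definition is_galois_aut (s : Fbar -> Fbar) : Prop :=
  [/\ GRing.zmod_morphism s, GRing.monoid_morphism s, bijective s &
      forall x, s (iota x) = iota x].

Record gal_aut := GalAut {
  gal_fun :> Fbar -> Fbar;
  _ : `[< is_galois_aut gal_fun >] }.

HB.instance Definition _ := [isSub for gal_fun].
HB.instance Definition _ := [Choice of gal_aut by <:].

Lemma gal_autP (s : gal_aut) : is_galois_aut s.
Proof. by case: s => s sP; apply/asboolP. Qed.

Lemma gal_eqP (s t : gal_aut) : s =1 t -> s = t.
Proof. by move=> st; apply: val_inj; apply/funext. Qed.

Lemma gal_one_subproof : `[< is_galois_aut id >].
Proof. by apply/asboolP; split=> //; exists id. Qed.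

Lemma gal_mul_subproof (s t : gal_aut) : `[< is_galois_aut (s \o t) >].
Proof.
have [sB [s1 sM] sb sF] := gal_autP s; have [tB [t1 tM] tb tF] := gal_autP t.
apply/asboolP; split; last by move=> x /=; rewrite tF sF.
- by move=> x y /=; rewrite tB sB.
- by split=> [|x y] /=; rewrite ?t1 // tM sM.
- exact: bij_comp.
Qed.

Lemma gal_inv_exists (s : gal_aut) :
  exists t : gal_aut, cancel s t /\ cancel t s.
Proof.
have [sB [s1 sM] [t st ts] sF] := gal_autP s.
have tP : `[< is_galois_aut t >].
  apply/asboolP; split; last by move=> x; apply: (can_inj st); rewrite ts.
  - by move=> x y; apply: (can_inj st); rewrite sB !ts.
  - by split=> [|x y]; apply: (can_inj st); rewrite ?sM !ts.
  - by exists s.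
by exists (GalAut tP).
Qed.

Definition gal_one : gal_aut := GalAut gal_one_subproof.
Definition gal_mul (s t : gal_aut) : gal_aut := GalAut (gal_mul_subproof s t).
Definition gal_inv (s : gal_aut) : gal_aut := sval (cid (gal_inv_exists s)).

Lemma gal_mulA : associative gal_mul.
Proof. by move=> s t u; apply: gal_eqP. Qed.
Lemma gal_mul1 : left_id gal_one gal_mul.
Proof. by move=> s; apply: gal_eqP. Qed.
Lemma gal_1mul : right_id gal_one gal_mul.
Proof. by move=> s; apply: gal_eqP. Qed.
Lemma gal_mulV : left_inverse gal_one gal_inv gal_mul.
Proof.
move=> s; apply: gal_eqP => x /=; rewrite /gal_inv.
by case: (cid _) => t [/= st _].
Qed.
Lemma gal_mulrV : right_inverse gal_one gal_inv gal_mul.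
Proof.
move=> s; apply: gal_eqP => x /=; rewrite /gal_inv.
by case: (cid _) => t [/= _ ts].
Qed.

HB.instance Definition _ := isGroup.Build gal_aut
  gal_mulA gal_mul1 gal_1mul gal_mulV gal_mulrV.

(* s induces x |-> x ^ (q ^ k) on the residue field of Fbar. *)
Definition acts_as_frobenius (q k : nat) (s : gal_aut) : Prop :=
  forall x, int_ring x -> max_ideal (s x - x ^+ (q ^ k)).

Definition inertia : set gal_aut :=
  [set s | forall x, int_ring x -> max_ideal (s x - x)]%classic.

Definition weil (q : nat) : set gal_aut :=
  [set s | exists k, acts_as_frobenius q k s
                  \/ acts_as_frobenius q k (s^-1)%g]%classic.

Definition geometric_frobenius (q : nat) (s : gal_aut) : Prop :=
  acts_as_frobenius q 1 (s^-1)%g.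

(* The topology of W_F: inertia, with its Krull topology, is an open subgroup.
   A basis of neighbourhoods of 1 is given by the elements of inertia fixing a
   finite set of elements of Fbar. *)
Definition weil_open (q : nat) (U : set gal_aut) : Prop :=
  (U `<=` weil q)%classic /\
  forall w, U w -> exists S : seq Fbar,
    forall i, inertia i -> (forall x, x \in S -> i x = x) -> U (w * i)%g.

(* A nontrivial (unitary, locally constant) additive character of F. *)
Definition additive_character (C : numClosedFieldType) (psi : F -> C) : Prop :=
  [/\ forall x y, psi (x + y) = psi x * psi y,
      forall x, `|psi x| = 1,
      exists k, forall x, int_ring (iota x) -> psi (p%:R ^+ k * x) = 1 &
      exists x, psi x != 1].

Section WeilRepresentations.
Variables (C : numClosedFieldType) (q : nat) (Fr : gal_aut).

(* As with morphisms of finite groups in the library, a homomorphism defined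
   on the Weil group is a total function whose values outside the Weil group
   are irrelevant. *)
Definition semisimple_parameter n (phi : gal_aut -> 'M[C]_n) : Prop :=
  [/\ forall w, weil q w -> phi w \in unitmx,
      forall v w, weil q v -> weil q w -> phi (v * w)%g = phi v *m phi w,
      weil_open q [set w | weil q w /\ phi w = 1%:M]%classic &
      forall w, weil q w -> diagonalizable (phi w)].

Definition irreducible_parameter n (phi : gal_aut -> 'M[C]_n) : Prop :=
  (0 < n)%N /\
  forall U : {vspace 'cV[C]_n},
    (forall w v, weil q w -> v \in U -> phi w *m v \in U) ->
    U = 0%VS \/ U = fullv.

Definition isomorphic_rep n (phi1 phi2 : gal_aut -> 'M[C]_n) : Prop :=
  exists2 A : 'M[C]_n, A \in unitmx &
    forall w, weil q w -> A *m phi1 w = phi2 w *m A.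

Definition dual_rep n (phi : gal_aut -> 'M[C]_n) : gal_aut -> 'M[C]_n :=
  fun w => (invmx (phi w))^T.

Definition tensor_rep m n (phi1 : gal_aut -> 'M[C]_m) (phi2 : gal_aut -> 'M[C]_n) :
  gal_aut -> 'M[C]_(m * n) := fun w => tensmx (phi1 w) (phi2 w).

Definition inertia_fixed n (phi : gal_aut -> 'M[C]_n) (U : {vspace 'cV[C]_n}) :=
  forall v, v \in U <-> forall i, inertia i -> phi i *m v = v.

Lemma inertia_fixed_exists n (phi : gal_aut -> 'M[C]_n) :
  exists U, inertia_fixed phi U.
Proof.
pose P (U : {vspace 'cV[C]_n}) :=
  forall v, v \in U -> forall i, inertia i -> phi i *m v = v.
have PD U V : P U -> P V -> P (U + V)%VS.
  move=> PU PV _ /memv_addP[u uU [v vV ->]] i iI.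
  by rewrite mulmxDr (PU u) ?(PV v).
have [U [PU Umax]] : exists U, P U /\ forall V, P V -> (\dim V <= \dim U)%N.
  have ex0 : exists d, `[< exists2 V, P V & \dim V = d >].
    exists 0%N; apply/asboolP; exists 0%VS; last exact: dimv0.
    by move=> v; rewrite memv0 => /eqP-> i _; rewrite mulmx0.
  have ub d : `[< exists2 V, P V & \dim V = d >] ->
      (d <= \dim {: 'cV[C]_n})%N.
    by move=> /asboolP[V _ <-]; apply/dimvS/subvf.
  case: (ex_maxnP ex0 ub) => d /asboolP[U PU <-] Umax; exists U; split=> // V PV.
  by apply: Umax; apply/asboolP; exists V.
exists U => v; split=> [vU i|vI]; first exact: PU.
have Pv : P <[v]>%VS.
  by move=> _ /vlineP[a ->] i iI; rewrite -scalemxAr vI.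
have: U == (U + <[v]>)%VS by rewrite eqEdim addvSl Umax //; apply: PD.
by move=> /eqP->; apply: (subvP (addvSr _ _)); apply: memv_line.
Qed.

(* V_phi^{I_F}, for the action of the Weil group on column vectors. *)
Definition inertia_invariants n (phi : gal_aut -> 'M[C]_n) : {vspace 'cV[C]_n} :=
  sval (cid (inertia_fixed_exists phi)).

(* The matrix of phi(Fr) on V_phi^{I_F}. *)
Definition frobenius_on_invariants n (phi : gal_aut -> 'M[C]_n) :=
  let b := vbasis (inertia_invariants phi) in
  \matrix_(i < \dim (inertia_invariants phi),
           j < \dim (inertia_invariants phi)) coord b i (phi Fr *m tnth b j).

(* The field C(X) of rational functions in X = q^{-s}. *)
Local Notation K := {fraction {poly C}}.

Definition ratC (c : C) : K := FracField.tofrac c%:P.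
Definition ratX : K := FracField.tofrac 'X.

(* L(s, phi) as a function of the value u of q^{-s}. *)
Definition L_factor n (phi : gal_aut -> 'M[C]_n) (u : K) : K :=
  (\det (1%:M - u *: map_mx ratC (frobenius_on_invariants phi)))^-1.

(* An epsilon factor is a monomial c * (q^{-s})^k with c nonzero, given by
   the pair (c, k). *)
Definition epsilon_system :=
  (F -> C) -> forall n, (gal_aut -> 'M[C]_n) -> C * int.

Definition monomial_epsilon (eps : epsilon_system) : Prop :=
  forall psi n (phi : gal_aut -> 'M[C]_n),
    additive_character psi -> semisimple_parameter phi ->
    (eps psi n phi).1 != 0.

(* gamma(s, phi, psi) as a function of the value u of q^{-s}; the value of
   q^{-(1-s)} is then q^{-1} u^{-1}. *)
Definition gamma_factor (eps : epsilon_system) (psi : F -> C)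
    n (phi : gal_aut -> 'M[C]_n) (u : K) : K :=
  ratC (eps psi n phi).1 * u ^ (eps psi n phi).2
  * L_factor (dual_rep phi) ((ratC q%:R)^-1 * u^-1) / L_factor phi u.

(* The divisor of a nonzero rational function on C^*, as the function mapping
   a point to its multiplicity. *)
Definition divisor (f : K) : {a : C | a != 0} -> int :=
  fun a => (mup (val a) (\n_(repr f)))%:Z - (mup (val a) (\d_(repr f)))%:Z.

Definition Gamma (eps : epsilon_system) (psi : F -> C) m n
    (phi1 : gal_aut -> 'M[C]_m) (phi2 : gal_aut -> 'M[C]_n) :=
  divisor
    (gamma_factor eps psi (tensor_rep (dual_rep phi1) phi2) ratX
     * gamma_factor eps (fun x => (psi x)^*%R) (tensor_rep phi1 (dual_rep phi2)) ratX^-1).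

End WeilRepresentations.
End WeilGroup.

(* Main.v *)
Require Import Defs.
From HB Require Import structures.
From mathcomp Require Import all_boot all_order all_algebra all_field.
From mathcomp Require Import boolp classical_sets reals.
From mathcomp Require Import complex mxtens.
From mathcomp Require Import ring.
Set Implicit Arguments.
Unset Strict Implicit.
Unset Printing Implicit Defensive.

(** Write X = q^{-s}, and let N(y) be the number of eigenvalues d of Frobenius
    on Hom_I(tau, phi), the inertia invariants of tau^* (x) phi, such that
    d^-1 = y. The dual tau (x) phi^* has the inverse eigenvalues
    ([frob_spectrum_contragredient]), so the four L-factors of Gamma(tau, phi)
    are explicit products of factors 1 - c X and 1 - c X^-1, and on C^* the
    multiplicity of Gamma(tau, phi) at y is 2 N(y) - N(q y) - N(q^-1 y)
    ([divisor_L_quotient], [Gamma_spectrum]). A function of finite support whose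
    second difference along the orbits of multiplication by q vanishes is zero,
    because q is not a root of unity ([second_difference_inj]). Hence
    Gamma(tau, phi) determines N, and in particular N(1), the dimension of
    Hom_W(tau, phi) ([Gamma_multiplicity]).

    It remains to see that phi is determined by the dimensions of Hom_W(tau, phi)
    for the irreducible tau of dimension at most that of phi
    ([iso_of_multiplicities]). This follows by splitting off a common irreducible
    constituent of phi1 and phi2 and inducting on the dimension, provided that
    subrepresentations have complements ([complete_reducibility]). A parameter
    is only assumed to have diagonalizable values, so complete reducibility
    needs a proof. The image of inertia is finite since the kernel is open
    ([open_kernel_finite_image]), and averaging over it gives an idempotent that
    commutes with the diagonalizable phi(Fr). In a common eigenbasis of the two
    one sees a projector onto the W-invariants, which is functorial
    ([weil_projector_natural]). Applied to the space Hom(phi, tau), it makes a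
    linear retraction onto tau equivariant.

    The arithmetic input is that the Weil group is the union of the cosets
    Fr^k I, with inertia I stable under conjugation ([weil_inertial]), and that
    q > 1 ([residue_card_gt1]). Both rest on the fact that the elements integral
    over p Z_p form a Galois stable proper ideal of the integral closure of Z_p
    ([max_idealP], [max_idealD]). *)

Import Order.TTheory GRing.Theory Num.Theory.
Local Open Scope ring_scope.

(** * The valuation ring of the algebraic closure under Galois *)

Section GaloisAction.
Variables (p : nat) (p_pr : prime p) (F : fieldExtType (Qp p_pr)).
Variables (Fbar : closedFieldType) (iota : {rmorphism F -> Fbar}).
Local Notation gal := (gal_aut iota).
Local Notation Zp := (padic_int p_pr).
Local Notation O := (int_ring iota).
Local Notation m := (max_ideal iota).
Implicit Types (s t : gal) (x y : Fbar).

Lemma gal_zmod_morphism s : GRing.zmod_morphism s.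
Proof. by case: (gal_autP s). Qed.
Lemma gal_monoid_morphism s : GRing.monoid_morphism s.
Proof. by case: (gal_autP s). Qed.
HB.instance Definition _ s :=
  GRing.isZmodMorphism.Build Fbar Fbar s (gal_zmod_morphism s).
HB.instance Definition _ s :=
  GRing.isMonoidMorphism.Build Fbar Fbar s (gal_monoid_morphism s).

Lemma gal_fix s (x : F) : s (iota x) = iota x.
Proof. by case: (gal_autP s). Qed.

Lemma gal_autM s t x : (s * t)%g x = s (t x).
Proof. by []. Qed.

Lemma gal_autK s x : (s^-1)%g (s x) = x.
Proof. by rewrite -gal_autM mulVg. Qed.

Lemma gal_autVK s x : s ((s^-1)%g x) = x.
Proof. by rewrite -gal_autM mulgV. Qed.

HB.instance Definition _ :=
  GRing.RMorphism.copy (of_Zp iota)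
    (iota \o (in_alg F \o @FracField.tofrac Zp)).

Lemma of_Zp_inj : injective (of_Zp iota).
Proof.
move=> x y /fmorph_inj /fmorph_inj /eqP; rewrite tofrac_eq => /eqP //.
Qed.

Lemma gal_of_Zp s z : s (of_Zp iota z) = of_Zp iota z.
Proof. exact: gal_fix. Qed.

Lemma gal_root s (f : {poly Zp}) x :
  root (map_poly (of_Zp iota) f) x -> root (map_poly (of_Zp iota) f) (s x).
Proof.
move=> fx; suff <- : map_poly s (map_poly (of_Zp iota) f) = map_poly (of_Zp iota) f.
  exact: rmorph_root.
by rewrite -map_poly_comp; apply: eq_map_poly => z; apply: gal_of_Zp.
Qed.

Lemma gal_int s x : O x -> O (s x).
Proof. by move=> [f f_monic fx]; exists f => //; apply: gal_root. Qed.

Lemma gal_max_ideal s x : m x -> m (s x).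
Proof. by move=> [f [f_monic fp fx]]; exists f; split => //; apply: gal_root. Qed.

Lemma padic_natE k n : (k%:R : Zp) n = (k%:Z %% (p ^ n)%N%:Z)%Z.
Proof.
elim: k => [|k IH]; first by [].
by rewrite -natr1 /= IH /= modzDm -addn1 PoszD.
Qed.

Lemma padic_p_nonunit (c : Zp) : p%:R * c != 1.
Proof.
apply/eqP => /(congr1 (fun z : Zp => z 1%N)).
rewrite /= padic_natE expn1 modzz mul0r mod0z modz_small //.
by rewrite ltz_nat prime_gt1.
Qed.

Lemma max_ideal_int x : m x -> O x.
Proof. by move=> [f [f_monic _ fx]]; exists f. Qed.

(** Integrality over the ideal p Z_p means that a power is p times an integral
    element. For x a root of a monic f whose lower coefficients are divisible
    by p, the equation f(x) = 0 itself expresses x ^+ deg f as p times an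
    integral element. Conversely, if g(y) = 0 then y^d = - sum g_i y^i yields,
    after multiplication by p^d, a monic equation for p y whose lower
    coefficients are divisible by p; substituting 'X^n.+1 in it gives one
    for x. Unlike the definition, this criterion makes stability under sums
    accessible. *)
Lemma max_idealP x :
  m x <-> O x /\ exists n y, O y /\ x ^+ n.+1 = p%:R * y.
Proof.
split=> [mx | [_ [n [y [[g g_monic gy] xy]]]]].
  split; first exact: max_ideal_int.
  case: mx => f [f_monic fp fx].
  have xO : O x by exists f.
  have [k sf] : exists k, size f = k.+1.
    by exists (size f).-1; rewrite prednK // lt0n size_poly_eq0 monic_neq0.
  case: k sf => [|k] sf.
    have f1 : f = 1.
      have := monicP f_monic; rewrite lead_coefE sf /= => f0.
      by rewrite (size1_polyC (eq_leq sf)) f0.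
    by move: fx; rewrite f1 rmorph1 (negbTE (root1 _)).
  have /fin_all_exists[c cP] (i : 'I_k.+1) : exists c, f`_i = p%:R * c.
    by apply: fp; rewrite sf /=.
  pose y := - \sum_(i < k.+1) of_Zp iota (c i) * x ^+ i.
  exists k, y; split.
    apply: (@integral_opp _ _ (of_Zp iota)); apply: (big_ind O).
    - exact: integral0.
    - exact: integral_add.
    move=> i _; apply: integral_mul; first exact: integral_id.
    by elim: (nat_of_ord i) => [|j IH]; [apply: integral1 | rewrite exprS; apply: integral_mul].
  move: fx; rewrite rootE horner_coef size_map_poly_id0; last first.
    by rewrite (monicP f_monic) rmorph1 oner_eq0.
  rewrite sf big_ord_recr /= !coef_map /=.
  have -> : f`_k.+1 = 1 by rewrite -(monicP f_monic) lead_coefE sf.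
  rewrite rmorph1 mul1r addrC addr_eq0 => /eqP->.
  rewrite mulrN mulr_sumr; congr (- _); apply: eq_bigr => i _.
  by rewrite coef_map /= cP rmorphM rmorph_nat mulrA.
pose d := (size g).-1.
have sg : size g = d.+1 by rewrite prednK // lt0n size_poly_eq0 monic_neq0.
have gd : g`_d = 1 by rewrite -(monicP g_monic) lead_coefE.
pose h := \poly_(i < d.+1) (p%:R ^+ (d - i) * g`_i).
have hd : h`_d = 1 by rewrite coef_poly leqnn subnn mul1r.
have sh : size h = d.+1 by rewrite size_poly_eq // subnn mul1r gd oner_neq0.
have sX : size ('X^(n.+1) : {poly Zp}) = n.+2 by rewrite size_polyXn.
have sf : size (h \Po 'X^(n.+1)) = (d * n.+1).+1.
  rewrite -[LHS]prednK ?size_comp_poly ?sX ?sh //.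
  by rewrite lt0n size_poly_eq0 comp_poly_eq0 ?sX // -size_poly_eq0 sh.
exists (h \Po 'X^(n.+1)); split.
- by rewrite monicE lead_coef_comp ?sX // lead_coefXn expr1n mulr1 lead_coefE sh hd.
- move=> i; rewrite sf /= coef_comp_poly_Xn // => lti.
  case: ifP => [/dvdnP[j ij]|_]; last by exists 0; rewrite mulr0.
  move: lti; rewrite ij mulnK // ltn_pmul2r // => ltj.
  rewrite coef_poly ltnS (ltnW ltj).
  exists (p%:R ^+ (d - j).-1 * g`_j); rewrite mulrA -exprS prednK //.
  by rewrite subn_gt0.
rewrite rootE map_comp_poly /= map_polyXn horner_comp hornerXn xy.
rewrite horner_coef size_map_poly_id0; last first.
  by rewrite lead_coefE sh hd rmorph1 oner_eq0.
rewrite sh; apply/eqP; transitivity (p%:R ^+ d * (map_poly (of_Zp iota) g).[y]).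
  rewrite horner_coef size_map_poly_id0; last first.
    by rewrite (monicP g_monic) rmorph1 oner_eq0.
  rewrite sg mulr_sumr; apply: eq_bigr => i _.
  rewrite !coef_map /= coef_poly ltn_ord rmorphM rmorphXn rmorph_nat.
  rewrite exprMn mulrACA -exprD subnK ?mulrA // -ltnS; exact: ltn_ord.
by rewrite (rootP gy) mulr0.
Qed.

Lemma int_exp x k : O x -> O (x ^+ k).
Proof.
move=> xO; elim: k => [|k IH]; first exact: integral1.
by rewrite exprS; apply: integral_mul.
Qed.

Lemma max_ideal0 : m 0.
Proof.
apply/max_idealP; split; first exact: integral0.
by exists 0, 0; split; [apply: integral0 | rewrite expr1 mulr0].
Qed.

Lemma max_ideal_mul x y : m x -> O y -> m (x * y).
Proof.
move=> /max_idealP[xO [n [z [zO xz]]]] yO; apply/max_idealP.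
split; first exact: integral_mul.
exists n, (z * y ^+ n.+1); split; first by apply: integral_mul => //; apply: int_exp.
by rewrite exprMn xz mulrA.
Qed.

Lemma max_idealN x : m x -> m (- x).
Proof.
by move=> mx; rewrite -mulrN1; apply: max_ideal_mul => //; apply: integral_opp; apply: integral1.
Qed.

(** Each term of the binomial expansion of (x + y)^(k + l + 1) is divisible by
    x^(k + 1) or by y^(l + 1), hence by p. *)
Lemma max_idealD x y : m x -> m y -> m (x + y).
Proof.
move=> /max_idealP[xO [k [z [zO xz]]]] /max_idealP[yO [l [w [wO yw]]]].
apply/max_idealP; split; first exact: integral_add.
have /fin_all_exists[c cP] (i : 'I_(k + l).+2) : exists c,
    O c /\ x ^+ ((k + l).+1 - i) * y ^+ i = p%:R * c.
  have [li|li] := leqP l.+1 i.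
    exists (x ^+ ((k + l).+1 - i) * (w * y ^+ (i - l.+1))); split.
      by do 2?apply: integral_mul => //; apply: int_exp.
    have -> : y ^+ i = p%:R * (w * y ^+ (i - l.+1)).
      by rewrite mulrA -yw -exprD subnKC.
    by rewrite mulrCA.
  have ki : (k.+1 <= (k + l).+1 - i)%N by rewrite ltn_subRL ltnS addnC leq_add2l.
  exists (z * x ^+ ((k + l).+1 - i - k.+1) * y ^+ i); split.
    by do 2?apply: integral_mul => //; apply: int_exp.
  have -> : x ^+ ((k + l).+1 - i) = p%:R * (z * x ^+ ((k + l).+1 - i - k.+1)).
    by rewrite mulrA -xz -exprD subnKC.
  by rewrite -!mulrA.
exists (k + l)%N, (\sum_(i < (k + l).+2) c i *+ 'C((k + l).+1, i)); split.
  apply: (big_ind O) => [||i _]; [exact: integral0|exact: integral_add|].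
  rewrite -mulr_natr; apply: integral_mul; first by case: (cP i).
  exact: integral_nat.
rewrite exprDn mulr_sumr; apply: eq_bigr => i _.
by rewrite (cP i).2 mulrnAr.
Qed.

Lemma max_ideal_trans y x z : m (x - y) -> m (y - z) -> m (x - z).
Proof. by move=> /max_idealD xy /xy; rewrite subrKA. Qed.

Lemma max_ideal_sym x y : m (x - y) -> m (y - x).
Proof. by move=> /max_idealN; rewrite opprB. Qed.

Lemma max_ideal_exp x y k : O x -> O y -> m (x - y) -> m (x ^+ k - y ^+ k).
Proof.
move=> xO yO mxy; rewrite subrXX; apply: max_ideal_mul => //.
apply: (big_ind O) => [||i _]; [exact: integral0|exact: integral_add|].
by apply: integral_mul; apply: int_exp.
Qed.

(** A monic f over Z_p with lower coefficients in p Z_p satisfies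
    f(1) = 1 mod p, so that 1 is not one of its roots. *)
Lemma max_ideal1 : ~ m 1.
Proof.
move=> [f [f_monic fp]]; rewrite rootE -(rmorph1 (of_Zp iota)) horner_map /=.
rewrite -(rmorph0 (of_Zp iota)) => /eqP/of_Zp_inj.
have [k sf] : exists k, size f = k.+1.
  by exists (size f).-1; rewrite prednK // lt0n size_poly_eq0 monic_neq0.
have /fin_all_exists[c cP] (i : 'I_k) : exists c, f`_i = p%:R * c.
  by apply: fp; rewrite sf /=.
rewrite horner_coef sf big_ord_recr /= expr1n mulr1.
have -> : f`_k = 1 by rewrite -(monicP f_monic) lead_coefE sf.
rewrite (eq_bigr (fun i => p%:R * c i)) => [|i _]; last by rewrite cP expr1n mulr1.
rewrite -mulr_sumr addrC => /eqP; rewrite addr_eq0 -mulrN eq_sym.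
exact/negP/padic_p_nonunit.
Qed.

End GaloisAction.

(** * The structure of the Weil group *)

(** The only facts about the Weil group used in the representation theory: a
    conjugation-stable subgroup I, and a W made of the cosets Fr^k I, k an
    integer. That W is itself a group is a consequence. *)
Record inertial_group (G : groupType) (W I : set G) (Fr : G) : Prop := InertialGroup {
  inertial1 : I 1%g;
  inertialM : forall i j, I i -> I j -> I (i * j)%g;
  inertialV : forall i, I i -> I (i^-1)%g;
  inertialJ : forall t i, I i -> I (i ^ t)%g;
  frob_coset : forall w, W w <->
    exists k i, I i /\ (w = Fr ^+ k * i \/ w = Fr ^- k * i)%g }.

Section InertialGroup.
Variables (G : groupType) (W I : set G) (Fr : G).
Hypothesis WI : inertial_group W I Fr.

Let cosetP k i : I i -> W (Fr ^+ k * i)%g.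
Proof. by move=> Ii; apply/(frob_coset WI); exists k, i; split=> //; left. Qed.
Let cosetVP k i : I i -> W (Fr ^- k * i)%g.
Proof. by move=> Ii; apply/(frob_coset WI); exists k, i; split=> //; right. Qed.

Lemma inertial_sub i : I i -> W i.
Proof. by move=> Ii; rewrite -(mul1g i) -(expg0 Fr); apply: cosetP. Qed.

Lemma weil1 : W 1%g.
Proof. exact: inertial_sub (inertial1 WI). Qed.

Lemma weil_Fr : W Fr.
Proof. by rewrite -[Fr]mulg1 -(expg1 Fr); apply: cosetP; apply: (inertial1 WI). Qed.

Let weilMI w i : W w -> I i -> W (w * i)%g.
Proof.
move=> /(frob_coset WI)[k [j [Ij [->|->]]]] Ii; rewrite -mulgA.
  by apply: cosetP; apply: (inertialM WI).
by apply: cosetVP; apply: (inertialM WI).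
Qed.

Let weilMF w : W w -> W (w * Fr)%g.
Proof.
move=> /(frob_coset WI)[k [j [Ij [->|->]]]]; rewrite -mulgA (conjgC j) mulgA.
  by rewrite -expgSr; apply: cosetP; apply: (inertialJ WI).
case: k => [|k].
  rewrite expg0 invg1 mul1g -{1}(expg1 Fr); apply: cosetP; exact: (inertialJ WI).
by rewrite expgS invgM mulgVK; apply: cosetVP; apply: (inertialJ WI).
Qed.

Let weilMFV w : W w -> W (w * Fr^-1)%g.
Proof.
move=> /(frob_coset WI)[k [j [Ij [->|->]]]]; rewrite -mulgA (conjgC j) mulgA.
  case: k => [|k].
    rewrite expg0 mul1g -{1}(expg1 Fr); apply: cosetVP; exact: (inertialJ WI).
  by rewrite expgSr mulgK; apply: cosetP; apply: (inertialJ WI).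
by rewrite -invgM -expgS; apply: cosetVP; apply: (inertialJ WI).
Qed.

Let weilMFX w k : W w -> W (w * Fr ^+ k)%g.
Proof.
move=> Ww; elim: k => [|k IH]; first by rewrite expg0 mulg1.
by rewrite expgSr mulgA; apply: weilMF.
Qed.

Let weilMFXV w k : W w -> W (w * Fr ^- k)%g.
Proof.
move=> Ww; elim: k => [|k IH]; first by rewrite expg0 invg1 mulg1.
by rewrite expgS invgM mulgA; apply: weilMFV.
Qed.

Lemma weilM v w : W v -> W w -> W (v * w)%g.
Proof.
by move=> Wv /(frob_coset WI)[k [j [Ij [->|->]]]]; rewrite mulgA; apply: weilMI => //;
  [apply: weilMFX | apply: weilMFXV].
Qed.

Lemma weilV w : W w -> W (w^-1)%g.
Proof.
move=> /(frob_coset WI)[k [j [Ij [->|->]]]]; rewrite invgM ?invgK.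
  by apply: weilMFXV; apply/inertial_sub/(inertialV WI).
by apply: weilMFX; apply/inertial_sub/(inertialV WI).
Qed.
End InertialGroup.

Section WeilStructure.
Variables (p : nat) (p_pr : prime p) (F : fieldExtType (Qp p_pr)).
Variables (Fbar : closedFieldType) (iota : {rmorphism F -> Fbar}).
Local Notation gal := (gal_aut iota).
Local Notation O := (int_ring iota).
Local Notation m := (max_ideal iota).
Implicit Types (s t : gal) (x y : Fbar).

Lemma residue_card_gt1 q : residue_card iota q -> (1 < q)%N.
Proof.
move=> [r [_ rP]]; have O0 : O (iota 0) by rewrite rmorph0; apply: integral0.
have O1 : O (iota 1) by rewrite rmorph1; apply: integral1.
have : r 0 <> r 1.
  move=> /rP -/(_ O0 O1); rewrite sub0r rmorphN rmorph1 => /max_idealN.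
  by rewrite opprK => /max_ideal1.
move: (r 0) (r 1); case: q {r rP} => [[]//|[|q]] //.
by move=> a b; rewrite !ord1.
Qed.

Lemma inertiaJ t i : inertia i -> inertia (i ^ t)%g.
Proof.
move=> iI x xO; rewrite conjgE !gal_autM -{2}(gal_autK t x) -raddfB.
by apply/gal_max_ideal/iI/gal_int.
Qed.

Lemma inertiaM i j : inertia i -> inertia j -> inertia (i * j : gal)%g.
Proof.
move=> iI jI x xO; apply: (@max_ideal_trans _ _ _ _ iota (j x)); last exact: jI.
by rewrite gal_autM; apply/iI/gal_int.
Qed.

Lemma inertiaV i : inertia i -> inertia (i^-1 : gal)%g.
Proof.
move=> iI x xO; apply: max_ideal_sym.
by rewrite -{1}(gal_autVK i x); apply/iI/gal_int.
Qed.

Variable q : nat.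

Lemma acts_as_frobenius0 s : acts_as_frobenius q 0 s <-> inertia s.
Proof. by split=> sP x /sP; rewrite expn0 expr1. Qed.

Lemma acts_as_frobeniusM k l s t :
  acts_as_frobenius q k s -> acts_as_frobenius q l t ->
  acts_as_frobenius q (k + l) (s * t)%g.
Proof.
move=> sP tP x xO; have txO := gal_int t xO.
apply: (@max_ideal_trans _ _ _ _ iota (t x ^+ (q ^ k))); first exact: sP.
rewrite addnC expnD exprM; apply: max_ideal_exp => //; first exact: int_exp.
exact: tP.
Qed.

Variable Fr : gal.
Hypothesis Fr_frob : geometric_frobenius q Fr.

Lemma frob_acts k : acts_as_frobenius q k (Fr ^- k)%g.
Proof.
elim: k => [|k IH].
  by apply/acts_as_frobenius0 => x xO; rewrite expg0 invg1 subrr; apply: max_ideal0.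
by rewrite expgS invgM -addn1; apply: acts_as_frobeniusM.
Qed.

Lemma acts_inertia k s : acts_as_frobenius q k s -> inertia (Fr ^+ k * s)%g.
Proof.
move=> sP x xO; rewrite gal_autM -{2}(gal_autVK (Fr ^+ k)%g x) -raddfB.
apply: gal_max_ideal.
apply: (max_ideal_trans (sP x xO)); apply: max_ideal_sym; exact: frob_acts.
Qed.

(** If s acts on the residue field as the k-th power of x |-> x^q, then so does
    Fr^-k, hence Fr^k s is in inertia. As inertia is stable under conjugation,
    the elements whose inverse acts in this way are of the form Fr^k i too. *)
Lemma weil_inertial : inertial_group (weil q) (@inertia _ _ _ _ iota) Fr.
Proof.
split.
- by move=> x xO; rewrite subrr; apply: max_ideal0.
- exact: inertiaM.
- exact: inertiaV.
- exact: inertiaJ.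
move=> w; split=> [[k [wP|wP]]|[k [i [iI [->|->]]]]].
- exists k, (Fr ^+ k * w)%g; split; first exact: acts_inertia.
  by right; rewrite mulKg.
- have := acts_inertia wP; set i := (Fr ^+ k * _)%g => iI.
  exists k, ((i^-1) ^ (Fr ^+ k))%g; split; first exact/inertiaJ/inertiaV.
  by left; rewrite -conjgC invgM invgK mulgVK.
- exists k; right; rewrite invgM; apply: (@acts_as_frobeniusM 0 k).
    exact/acts_as_frobenius0/inertiaV.
  exact: frob_acts.
- exists k; left; rewrite -[X in acts_as_frobenius _ X _]addn0; apply: acts_as_frobeniusM.
    exact: frob_acts.
  exact/acts_as_frobenius0.
Qed.

Hypothesis Fbar_closure : algebraic_closure iota.

(** An automorphism over F permutes the roots of a polynomial over F, and each
    member of S is such a root. *)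
Lemma gal_orbit_finite (S : seq Fbar) :
  exists T : seq (seq Fbar), forall s, map s S \in T.
Proof.
elim: S => [|x S [T TP]]; first by exists [:: [::]] => s; rewrite inE.
have [f f0 fx] := Fbar_closure x.
have [r rP] := closed_field_poly_normal (map_poly iota f).
exists (allpairs cons r T) => s; apply: allpairs_f; last exact: TP.
have : root (map_poly iota f) (s x).
  rewrite -[map_poly iota f](_ : map_poly s (map_poly iota f) = _).
    exact: rmorph_root.
  by rewrite -map_poly_comp; apply: eq_map_poly => z; apply: gal_fix.
rewrite rP rootZ ?lead_coef_eq0 ?map_poly_eq0 //.
by rewrite root_prod_XsubC.
Qed.

(** Openness of the kernel at 1 provides a finite S such that phi i depends only
    on the restriction of i to S, which takes finitely many values. This is the
    only use made of the profiniteness of inertia. *)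
Lemma open_kernel_finite_image (C : numClosedFieldType) n (phi : gal -> 'M[C]_n) :
  semisimple_parameter q phi ->
  exists s : seq 'M[C]_n, forall i, inertia i -> phi i \in s.
Proof.
move=> [phiU phiM [_ phiO] _].
have WI := weil_inertial.
have [|S SP] := phiO 1%g.
  split; first exact: weil1 WI.
  have U1 := phiU _ (weil1 WI); rewrite -[LHS](mulKmx U1) -phiM ?mulg1 ?mulVmx //;
  exact: weil1 WI.
have [T TP] := gal_orbit_finite S.
(* The value of phi at some inertia element restricting to t; the default 0
   does not occur for the restriction of an inertia element. *)
pose rep (t : seq Fbar) :=
  if pselect (exists i, inertia i /\ map i S = t) is left e then phi (sval (cid e)) else 0.
exists (map rep T) => i iI; apply/mapP; exists (map i S) => //.
rewrite /rep; case: pselect => [e|[]]; last by exists i.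
case: (cid e) => j /= [jI ji].
have kI : inertia (j^-1 * i)%g by apply: inertiaM => //; apply: inertiaV.
have [|_] := SP _ kI.
  move=> x xS; rewrite gal_autM.
  have -> : i x = j x.
    have := congr1 (fun r : seq Fbar => nth 0 r (index x S)) ji.
    by rewrite !(nth_map 0) ?index_mem // nth_index.
  exact: gal_autK.
rewrite mul1g => phik.
have -> : i = (j * (j^-1 * i))%g by rewrite mulVKg.
by rewrite phiM ?phik ?mulmx1 //; apply: (inertial_sub WI).
Qed.
End WeilStructure.

(** * Linear algebra: diagonalization, idempotents, tensor products *)

Section LinearAlgebra.
Variable C : fieldType.

Lemma diagonalizable_conj n (A : 'M[C]_n) :
  diagonalizable A <->
  exists2 Q, Q \in unitmx & exists d, A = invmx Q *m diag_mx d *m Q.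
Proof.
split=> [[Q Qu /(diagonalizable_forLR Qu)[d ->]]|[Q Qu [d ->]]]; exists Q => //.
  by exists d; rewrite mxpoly.conjVmx.
by apply/(diagonalizable_forLR Qu); exists d; rewrite mxpoly.conjVmx.
Qed.

Lemma diagonalizable_tr n (A : 'M[C]_n) : diagonalizable A -> diagonalizable A^T.
Proof.
move=> /diagonalizable_conj[Q Qu [d ->]]; apply/diagonalizable_conj.
exists (invmx Q)^T; first by rewrite unitmx_tr unitmx_inv.
by exists d; rewrite -trmx_inv invmxK !trmx_mul tr_diag_mx mulmxA.
Qed.

(** S is the restriction of A to the column space of B, an A-stable subspace, and
    the minimal polynomial of S divides that of A. Stable subspaces are row
    spaces in diagonalizable_conj_diag, hence the transpositions. *)
Lemma diagonalizable_sub n m (A : 'M[C]_n) (S : 'M[C]_m) (B : 'M_(n, m)) (P : 'M_(m, n)) :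
  P *m B = 1%:M -> A *m B = B *m S -> diagonalizable A -> diagonalizable S.
Proof.
move=> PB AB Ad; rewrite -(trmxK S); apply: diagonalizable_tr.
have /diagonalizable_conj[Q Qu [d AT]] := diagonalizable_tr Ad.
pose V := B^T *m invmx Q.
have VS : V *m diag_mx d = S^T *m V.
  rewrite /V mulmxA -trmx_mul -AB trmx_mul AT -!mulmxA mulmxV ?mulmx1 //.
have Vfree : row_free V.
  by apply/row_freeP; exists (Q *m P^T); rewrite mulmxA mulmxKV // -trmx_mul PB trmx1.
have <- : mxpoly.conjmx V (diag_mx d) = S^T.
  by rewrite /mxpoly.conjmx VS mulmxKp.
apply: diagonalizable_conj_diag => //.
by rewrite VS submxMl.
Qed.

Lemma idempotent_diagonalizable n (e : 'M[C]_n) : e *m e = e -> diagonalizable e.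
Proof.
case: n e => [|n] e ee; first by rewrite [e]flatmx0; apply: diagonalizable0.
apply/diagonalizableP; exists [:: 0; 1]; first by rewrite /= inE eq_sym oner_eq0.
rewrite big_cons big_cons big_nil mulr1 subr0.
by rewrite mxminpoly_min // rmorphM rmorphB /= horner_mx_X horner_mx_C mulrBr mulr1 -[e * e]/(e *m e) ee subrr.
Qed.

Lemma diag_codiag n (A e : 'M[C]_n) :
  diagonalizable A -> e *m e = e -> A *m e = e *m A ->
  exists2 Q, Q \in unitmx &
    exists d (b : 'I_n -> bool), A = invmx Q *m diag_mx d *m Q /\
      e = invmx Q *m diag_mx (\row_i (b i)%:R) *m Q.
Proof.
move=> Ad ee Ae.
have [Q Qu] : codiagonalizable [:: A; e].
  apply/codiagonalizableP; split=> [X Y|X]; rewrite !inE.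
    by move=> /orP[]/eqP-> /orP[]/eqP->; rewrite /comm_mx.
  by move=> /orP[]/eqP-> //; apply: idempotent_diagonalizable.
move=> /and3P[/(diagonalizable_forLR Qu)[d Adef] /(diagonalizable_forLR Qu)[b edef] _].
move: Adef edef; rewrite !mxpoly.conjVmx // => Adef edef.
exists Q => //; exists d, (fun i => b 0 i == 1); split=> //.
rewrite edef; congr (_ *m diag_mx _ *m _); apply/rowP => i; rewrite mxE.
have : diag_mx b *m diag_mx b = diag_mx b.
  have := ee; rewrite edef !mulmxA mulmxK // => /(congr1 (mulmx^~ (invmx Q))).
  rewrite !mulmxK // => /(congr1 (mulmx Q)).
  by rewrite -!mulmxA !mulKVmx.
move=> /matrixP/(_ i i); rewrite mulmx_diag !mxE eqxx !mulr1n.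
move/eqP; rewrite -subr_eq0 -{3}(mulr1 (b 0 i)) -mulrBr mulf_eq0 subr_eq0.
by case/orP => /eqP->; rewrite ?eqxx // eq_sym oner_eq0.
Qed.

(** Both sides are the determinant of the block matrix (1, A; B, 1), eliminated
    along its first or second diagonal block. *)
Lemma det_1subC (K : comNzRingType) m n (A : 'M[K]_(m, n)) (B : 'M_(n, m)) :
  \det (1%:M - A *m B) = \det (1%:M - B *m A).
Proof.
have E1 : block_mx 1%:M A B 1%:M =
   block_mx 1%:M A 0 1%:M *m block_mx (1%:M - A *m B) 0 B 1%:M.
  by rewrite mulmx_block !mul1mx !mul0mx !mulmx1 !add0r subrK.
have E2 : block_mx 1%:M A B 1%:M =
   block_mx 1%:M 0 B 1%:M *m block_mx 1%:M A 0 (1%:M - B *m A).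
  by rewrite mulmx_block !mul1mx !mul0mx !mulmx1 !addr0 addrC subrK.
have := congr1 determinant E1; rewrite E2 !det_mulmx !det_ublock !det_lblock.
by rewrite !det1 !mul1r !mulr1.
Qed.

(** From e = c r with c injective and r surjective, e e = e reads
    c (r c) r = c r, and c and r can be cancelled. *)
Lemma idempotent_factor n (e : 'M[C]_n) : e *m e = e ->
  row_base e *m col_base e = 1%:M.
Proof.
move: (col_base_full e) (row_base_free e) (mulmx_base e).
move: (col_base e) (row_base e); move: (\rank e) => k c r.
move=> /row_fullP[L Lc] /row_freeP[R rR] <- /(congr1 (fun X => L *m X *m R)).
by rewrite !mulmxA Lc !mul1mx -!mulmxA rR !mulmx1.
Qed.

Lemma idempotent_trace n (e : 'M[C]_n) : e *m e = e -> \tr e = (\rank e)%:R.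
Proof.
by move=> ee; rewrite -{1}(mulmx_base e) mxtrace_mulC idempotent_factor // mxtrace1.
Qed.

(** Identifies Hom(C^m, C^n) with (C^m)^* (x) C^n in the basis order of tensmx, so
    that B^T (x) A becomes X |-> A X B. *)
Definition vec_hom m n (X : 'M[C]_(n, m)) : 'cV[C]_(m * n) :=
  \col_k X (mxtens_unindex k).2 (mxtens_unindex k).1.

Definition hom_vec m n (v : 'cV[C]_(m * n)) : 'M[C]_(n, m) :=
  \matrix_(i, j) v (mxtens_index (j, i)) 0.

Lemma hom_vecK m n : cancel (@hom_vec m n) (@vec_hom m n).
Proof.
by move=> v; apply/colP => k; rewrite !mxE -surjective_pairing mxtens_unindexK.
Qed.

Lemma vec_homK m n : cancel (@vec_hom m n) (@hom_vec m n).
Proof. by move=> X; apply/matrixP => i j; rewrite !mxE mxtens_indexK. Qed.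

Lemma tensmx_vec m n m' n' (A : 'M[C]_(n', n)) (B : 'M[C]_(m, m')) (X : 'M[C]_(n, m)) :
  tensmx B^T A *m vec_hom X = vec_hom (A *m X *m B).
Proof.
apply/colP => k; case: (mxtens_indexP k) => i j.
rewrite !mxE mxtens_indexK /=.
rewrite (reindex (@mxtens_index m n)) /=; last first.
  by exists (@mxtens_unindex m n) => k' _; rewrite ?mxtens_indexK ?mxtens_unindexK.
rewrite (eq_bigr (fun ab => B ab.1 i * A j ab.2 * X ab.2 ab.1)); last first.
  by move=> [a b] _; rewrite tensmxE !mxE mxtens_indexK.
rewrite -(pair_bigA _ (fun a b => B a i * A j b * X b a)) /=.
apply: eq_bigr => a _; rewrite !mxE mulr_suml; apply: eq_bigr => b _.
by rewrite -mulrA mulrC.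
Qed.

End LinearAlgebra.

(** * Inertia invariants and Frobenius eigenvalues *)

Section Representations.
Variables (C : numFieldType) (G : groupType) (W I : set G) (Fr : G).
Hypothesis WI : inertial_group W I Fr.

(** Finite-dimensional representations with finite image of inertia and
    diagonalizable Frobenius. Semisimple parameters are of this kind, and so are
    their duals, tensor products and subrepresentations; this is all that
    complete reducibility and the computation of L-factors require. *)
Record tame_rep n (rho : G -> 'M[C]_n) : Prop := TameRep {
  rep_unit : forall w, W w -> rho w \in unitmx;
  repM : forall v w, W v -> W w -> rho (v * w)%g = rho v *m rho w;
  rep_finite : exists s : seq 'M[C]_n, forall i, I i -> rho i \in s;
  rep_diag : diagonalizable (rho Fr) }.

Definition intertwines n1 n2 (rho1 : G -> 'M[C]_n1) (rho2 : G -> 'M[C]_n2)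
    (X : 'M[C]_(n2, n1)) :=
  forall w, W w -> rho2 w *m X = X *m rho1 w.

(** The analogues over any group of dual_rep and tensor_rep, to which they are
    convertible for Galois automorphisms. *)
Definition contragredient n (rho : G -> 'M[C]_n) w := (invmx (rho w))^T.
Definition tensor m n (rho1 : G -> 'M[C]_m) (rho2 : G -> 'M[C]_n) w :=
  tensmx (rho1 w) (rho2 w).

Let W1 := weil1 WI.
Let WV := weilV WI.
Let WM := weilM WI.
Let WFr := weil_Fr WI.
Let IW := inertial_sub WI.

Lemma rep1 n (rho : G -> 'M[C]_n) : tame_rep rho -> rho 1%g = 1%:M.
Proof.
move=> rhoT; have U1 := rep_unit rhoT W1.
by rewrite -[LHS](mulKmx U1) -(repM rhoT) // mulg1 mulVmx.
Qed.

Lemma repV n (rho : G -> 'M[C]_n) w : tame_rep rho -> W w ->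
  rho (w^-1)%g = invmx (rho w).
Proof.
move=> rhoT Ww; have Uw := rep_unit rhoT Ww.
rewrite -[LHS](mulmxK Uw) -(repM rhoT) //; last exact: WV.
by rewrite mulVg (rep1 rhoT) mul1mx.
Qed.

(** W consists of the products of a power of Fr by an element of I. *)
Lemma fixed_by_generators n k (rho : G -> 'M[C]_n) (v : 'M[C]_(n, k)) :
  tame_rep rho -> (forall i, I i -> rho i *m v = v) -> rho Fr *m v = v ->
  forall w, W w -> rho w *m v = v.
Proof.
move=> rhoT Iv Fv.
have FVv : rho (Fr^-1)%g *m v = v.
  by rewrite (repV rhoT) // -{1}Fv mulKmx // (rep_unit rhoT).
have X j w : W w -> rho w *m v = v -> W (w ^+ j)%g /\ rho (w ^+ j)%g *m v = v.
  move=> Ww wv; elim: j => [|j [Wj IH]].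
    by rewrite expg0 (rep1 rhoT) mul1mx.
  rewrite expgS; split; first exact: WM.
  by rewrite (repM rhoT) // -mulmxA IH.
move=> w /(frob_coset WI)[j [i [Ii [->|->]]]].
  have [Wj jv] := X j _ WFr Fv.
  by rewrite (repM rhoT) //; [rewrite -mulmxA Iv | apply: IW].
have [Wj jv] := X j _ (WV WFr) FVv.
by rewrite -expVgn (repM rhoT) //; [rewrite -mulmxA Iv | apply: IW].
Qed.

(** The projector onto the span of the coordinate vectors selected by b, in the
    basis given by Q. *)
Definition coord_projector n (Q : 'M[C]_n) (b : 'I_n -> bool) : 'M[C]_n :=
  invmx Q *m diag_mx (\row_j (b j)%:R) *m Q.

Lemma coord_projectorE n (Q : 'M[C]_n) b k (v : 'M[C]_(n, k)) i j : Q \in unitmx ->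
  (Q *m (coord_projector Q b *m v)) i j = (b i)%:R * (Q *m v) i j.
Proof.
by move=> Qu; rewrite /coord_projector -!mulmxA mulKVmx // mul_diag_mx !mxE.
Qed.

Lemma coord_projector_tr n (Q : 'M[C]_n) b :
  (coord_projector Q b)^T = coord_projector (invmx Q)^T b.
Proof.
by rewrite /coord_projector !trmx_mul tr_diag_mx mulmxA -trmx_inv invmxK.
Qed.

Lemma coord_projectorM n (Q : 'M[C]_n) b b' : Q \in unitmx ->
  coord_projector Q b *m coord_projector Q b' = coord_projector Q (fun i => b i && b' i).
Proof.
move=> Qu; rewrite /coord_projector !mulmxA mulmxK //; congr (_ *m Q).
rewrite -!mulmxA; congr (_ *m _); apply/matrixP => i j; rewrite mul_diag_mx !mxE.
by rewrite mulrnAr -natrM mulnb.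
Qed.

Lemma coord_projector_trace n (Q : 'M[C]_n) b : Q \in unitmx ->
  \tr (coord_projector Q b) = (\sum_i b i)%:R.
Proof.
move=> Qu; rewrite mxtrace_mulC mulmxA mulmxV // mul1mx mxtrace_diag natr_sum.
by apply: eq_bigr => i _; rewrite mxE.
Qed.

(** A basis of eigenvectors of Frobenius, with eigenvalues d, adapted to the
    inertia invariants: b selects the basis vectors that are fixed by inertia,
    and the corresponding coordinate projector is the projector onto the
    invariants that commutes with the group. The left and right conditions on
    it are exchanged by duality. *)
Record frob_spectrum n (rho : G -> 'M[C]_n) (Q : 'M[C]_n) (d : 'rV[C]_n)
    (b : 'I_n -> bool) : Prop := FrobSpectrum {
  spec_unit : Q \in unitmx;
  spec_neq0 : forall i, d 0 i != 0;
  spec_frob : rho Fr = invmx Q *m diag_mx d *m Q;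
  spec_fixl : forall i, I i ->
    rho i *m coord_projector Q b
      = coord_projector Q b;
  spec_fixr : forall i, I i ->
    coord_projector Q b *m rho i
      = coord_projector Q b;
  spec_idl : forall k (v : 'M[C]_(n, k)),
    (forall i, I i -> rho i *m v = v) ->
    coord_projector Q b *m v = v;
  spec_idr : forall k (v : 'M[C]_(k, n)),
    (forall i, I i -> v *m rho i = v) ->
    v *m coord_projector Q b = v }.

(** The average e of the finite group rho(I). It commutes with Frobenius because
    conjugation by rho(Fr) permutes rho(I). *)
Lemma inertia_average n (rho : G -> 'M[C]_n) : tame_rep rho ->
  exists e : 'M[C]_n, [/\ forall i, I i -> rho i *m e = e,
    forall i, I i -> e *m rho i = e,
    rho Fr *m e = e *m rho Fr,
    forall k (v : 'M[C]_(n, k)), (forall i, I i -> rho i *m v = v) -> e *m v = v &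
    forall k (v : 'M[C]_(k, n)), (forall i, I i -> v *m rho i = v) -> v *m e = v].
Proof.
move=> rhoT; have [s sP] := rep_finite rhoT.
pose H := undup [seq g <- s | `[< exists2 i, I i & rho i = g >]].
have HP g : g \in H <-> exists2 i, I i & rho i = g.
  rewrite mem_undup mem_filter; split=> [/andP[/asboolP]//|ig].
  by apply/andP; split; [apply/asboolP | case: ig => i /sP is_ <-].
have Hu : uniq H := undup_uniq _.
have H0 : (size H)%:R != 0 :> C.
  rewrite pnatr_eq0 size_eq0; apply/eqP => H0.
  have /HP : exists2 i, I i & rho i = rho 1%g by exists 1%g => //; exact: inertial1 WI.
  by rewrite H0.
have sumH f : injective f -> (forall g, g \in H -> f g \in H) ->
    \sum_(g <- H) f g = \sum_(g <- H) g.
  move=> f_inj fH; rewrite -(big_map f xpredT id); apply: perm_big.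
  have fHu : uniq (map f H) by rewrite map_inj_uniq.
  apply: uniq_perm => //; apply: (uniq_min_size fHu _ _).2; last by rewrite size_map.
  by move=> _ /mapP[g gH ->]; apply: fH.
pose e : 'M[C]_n := (size H)%:R^-1 *: \sum_(g <- H) g.
have avg k l (f : 'M[C]_n -> 'M[C]_(k, l)) v :
    (forall g, g \in H -> f g = v) -> (size H)%:R^-1 *: \sum_(g <- H) f g = v.
  move=> fv; rewrite big_seq (eq_bigr (fun=> v)) // -big_seq big_const_seq count_predT.
  by rewrite iter_addr_0 -scaler_nat scalerA mulVf // scale1r.
exists e; split=> [i Ii|i Ii||k v vP|k v vP].
- rewrite -scalemxAr mulmx_sumr sumH //.
    by apply: can_inj (mulKmx _); apply/(rep_unit rhoT)/IW.
  move=> _ /HP[j Ij <-]; apply/HP; exists (i * j)%g.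
    exact: inertialM WI _ _ _ _.
  by rewrite (repM rhoT) //; exact: IW.
- rewrite -scalemxAl mulmx_suml (sumH (mulmx^~ (rho i))) //.
    by apply: can_inj (mulmxK _); apply/(rep_unit rhoT)/IW.
  move=> _ /HP[j Ij <-]; apply/HP; exists (j * i)%g.
    exact: inertialM WI _ _ _ _.
  by rewrite (repM rhoT) //; exact: IW.
- have FU := rep_unit rhoT WFr.
  suff {2}<- : rho Fr *m e *m invmx (rho Fr) = e by rewrite mulmxKV.
  rewrite -scalemxAr mulmx_sumr -scalemxAl mulmx_suml.
  rewrite (sumH (fun g => rho Fr *m g *m invmx (rho Fr))) //.
    move=> g h /(congr1 (mulmx^~ (rho Fr))); rewrite !mulmxKV //.
    by move=> /(congr1 (mulmx (invmx (rho Fr)))); rewrite !mulKmx.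
  move=> _ /HP[j Ij <-]; apply/HP; exists (j ^ (Fr^-1))%g.
    exact: inertialJ WI _ _ _.
  have Wj := IW Ij; have WFV := WV WFr.
  by rewrite conjgE invgK mulgA !(repM rhoT) ?(repV rhoT) //; exact: WM.
- rewrite -scalemxAl mulmx_suml; apply: avg => _ /HP[i Ii <-]; exact: vP.
- rewrite -scalemxAr mulmx_sumr; apply: avg => _ /HP[i Ii <-]; exact: vP.
Qed.

Lemma invmx_eq n (A B : 'M[C]_n) : A *m B = 1%:M -> invmx A = B.
Proof.
by move=> AB; have [Au _] := mulmx1_unit AB; rewrite -[RHS](mulKmx Au) AB mulmx1.
Qed.

Lemma invmx_conj_diag n (Q : 'M[C]_n) (d : 'rV_n) : Q \in unitmx -> (forall i, d 0 i != 0) ->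
  invmx (invmx Q *m diag_mx d *m Q) = invmx Q *m diag_mx (\row_i (d 0 i)^-1) *m Q.
Proof.
move=> Qu d0; apply: invmx_eq; rewrite -!mulmxA mulKVmx // (mulmxA (diag_mx d)).
have -> : diag_mx d *m diag_mx (\row_i (d 0 i)^-1) = 1%:M.
  apply/matrixP => i j; rewrite mul_diag_mx !mxE mulrnAr mulfV //.
by rewrite mul1mx mulVmx.
Qed.

Lemma conj_diag_neq0 n (Q : 'M[C]_n) (d : 'rV_n) i : Q \in unitmx ->
  invmx Q *m diag_mx d *m Q \in unitmx -> d 0 i != 0.
Proof.
move=> Qu; rewrite !unitmx_mul unitmx_inv Qu andbT /=.
by rewrite unitmxE det_diag unitfE => /prodf_neq0; exact.
Qed.

(** The average over inertia is idempotent, hence diagonalizable, and commutes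
    with the diagonalizable rho(Fr): both are diagonal in a common basis. *)
Lemma frob_spectrum_exists n (rho : G -> 'M[C]_n) : tame_rep rho ->
  exists Q d b, frob_spectrum rho Q d b.
Proof.
move=> rhoT; have [e [el er eF fl fr]] := inertia_average rhoT.
have ee : e *m e = e by apply: fl.
have [Q Qu [d [b [dP bP]]]] := diag_codiag (rep_diag rhoT) ee eF.
have {}bP : coord_projector Q b = e by [].
exists Q, d, b; split; rewrite ?bP //.
by move=> i; apply: (conj_diag_neq0 _ Qu); rewrite -dP (rep_unit rhoT).
Qed.

(** The dual basis diagonalizes the dual representation: eigenvalues are inverted
    and the same indices are fixed by inertia. This is how the L-factor of the
    dual is read off from the spectrum of rho. *)
Lemma frob_spectrum_contragredient n (rho : G -> 'M[C]_n) Q d b :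
  tame_rep rho -> frob_spectrum rho Q d b ->
  frob_spectrum (contragredient rho) (invmx Q)^T (\row_i (d 0 i)^-1) b.
Proof.
move=> rhoT [Qu d0 FE il ir fl fr].
have inv_tr i : I i -> contragredient rho i = (rho (i^-1)%g)^T.
  by move=> Ii; rewrite (repV rhoT) //; apply: IW.
split; rewrite -?coord_projector_tr.
- by rewrite unitmx_tr unitmx_inv.
- by move=> i; rewrite mxE invr_eq0.
- rewrite /contragredient FE invmx_conj_diag // -(trmx_inv (invmx Q)) invmxK.
  by rewrite !trmx_mul tr_diag_mx mulmxA.
- by move=> i Ii; rewrite inv_tr // -trmx_mul ir //; apply: inertialV WI _ _.
- by move=> i Ii; rewrite inv_tr // -trmx_mul il //; apply: inertialV WI _ _.
- move=> k v vP; rewrite -{2}(trmxK v) -[v in LHS]trmxK -trmx_mul fr // => i Ii.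
  have IVi := inertialV WI Ii.
  by rewrite -[in RHS](vP _ IVi) inv_tr // trmx_mul trmxK invgK.
move=> k v vP; rewrite -{2}(trmxK v) -[v in LHS]trmxK -trmx_mul fl // => i Ii.
have IVi := inertialV WI Ii.
by rewrite -[in RHS](vP _ IVi) inv_tr // trmx_mul trmxK invgK.
Qed.

(** D is a basis of the inertia invariants and M the matrix of Frobenius in this
    basis. With e = D (L e) the projector onto the invariants, the determinant
    of 1 - u M is that of 1 - u rho(Fr) e on the whole space, by det_1subC;
    and rho(Fr) e is diagonal in the basis Q. *)
Lemma frob_spectrum_det (K : comNzRingType) (f : {rmorphism C -> K}) (u : K)
    n (rho : G -> 'M[C]_n) Q d b k (D : 'M_(n, k)) (L : 'M_(k, n)) (M : 'M_k) :
  frob_spectrum rho Q d b -> L *m D = 1%:M ->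
  (forall i, I i -> rho i *m D = D) ->
  (forall v : 'cV_n, (forall i, I i -> rho i *m v = v) -> exists c, v = D *m c) ->
  rho Fr *m D = D *m M ->
  \det (1%:M - u *: map_mx f M) = \prod_(i | b i) (1 - u * f (d 0 i)).
Proof.
move=> [Qu d0 FE il ir fl fr] LD ID DI FD.
(* e maps into the invariants, so it factors through the basis D. *)
set e := coord_projector Q b in il ir fl fr.
have eD : e *m D = D by apply: fl.
have De : D *m (L *m e) = e.
  apply/matrixP => i j.
  have [|c cP] := DI (col j e); first by move=> g Ig; rewrite !colE mulmxA il.
  have : col j (D *m (L *m e)) = col j e.
    by rewrite colE -(mulmxA D) -(mulmxA L) -colE cP (mulmxA L D c) LD mul1mx.
  by move/colP/(_ i); rewrite !mxE.
have LeD : L *m e *m D = 1%:M by rewrite -mulmxA eD.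
have -> : M = M *m (L *m e) *m D by rewrite -mulmxA LeD mulmx1.
rewrite map_mxM scalemxAl det_1subC -scalemxAr -map_mxM (mulmxA D M) -FD -(mulmxA (rho Fr)) De.
rewrite FE /e /coord_projector -!mulmxA mulKVmx // map_mxM scalemxAr det_1subC.
rewrite -scalemxAl -map_mxM -!mulmxA mulmxV // mulmx1.
have -> : 1%:M - u *: map_mx f (diag_mx d *m diag_mx (\row_j (b j)%:R))
   = diag_mx (\row_i if b i then 1 - u * f (d 0 i) else 1).
  apply/matrixP => i j; rewrite !mxE (bigD1 i) //= big1 => [|l li]; last first.
    by rewrite !mxE eq_sym (negbTE li) mulr0n mul0r.
  rewrite !mxE eqxx addr0 mulr1n.
  case: eqP => _; rewrite ?mulr0n ?mulr1n; last by rewrite mulr0 rmorph0 mulr0 subr0.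
  by case: (b i); rewrite ?mulr1 // mulr0 rmorph0 mulr0 subr0.
by rewrite det_diag [RHS]big_mkcond /=; apply: eq_bigr => i _; rewrite mxE.
Qed.

(** The projector onto the W-invariants along the other isotypic components. The
    last two conditions make it functorial in the representation, and its trace
    is the dimension of the invariants. *)
Record weil_projector n (rho : G -> 'M[C]_n) (Pi : 'M[C]_n) : Prop := WeilProjector {
  projl : forall w, W w -> rho w *m Pi = Pi;
  projr : forall w, W w -> Pi *m rho w = Pi;
  proj_idl : forall k (v : 'M[C]_(n, k)),
    (forall w, W w -> rho w *m v = v) -> Pi *m v = v;
  proj_idr : forall k (v : 'M[C]_(k, n)),
    (forall w, W w -> v *m rho w = v) -> v *m Pi = v }.

Lemma contragredientV n (rho : G -> 'M[C]_n) w : tame_rep rho -> W w ->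
  contragredient rho w = (rho (w^-1)%g)^T.
Proof. by move=> rhoT Ww; rewrite repV. Qed.

Lemma tame_contragredient n (rho : G -> 'M[C]_n) :
  tame_rep rho -> tame_rep (contragredient rho).
Proof.
move=> rhoT; split.
- by move=> w Ww; rewrite unitmx_tr unitmx_inv (rep_unit rhoT).
- move=> v w Wv Ww; have VW := WM Wv Ww; rewrite !contragredientV //.
  by rewrite invgM (repM rhoT) ?trmx_mul //; exact: WV.
- have [s sP] := rep_finite rhoT; exists [seq g^T | g <- s] => i Ii.
  rewrite contragredientV //; last exact: IW.
  by apply/map_f/sP/(inertialV WI).
have /diagonalizable_tr/diagonalizable_conj[Q Qu [d FE]] := rep_diag rhoT.
apply/diagonalizable_conj; exists Q => //; exists (\row_i (d 0 i)^-1).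
rewrite /contragredient trmx_inv FE invmx_conj_diag // => i.
by apply: (conj_diag_neq0 _ Qu); rewrite -FE unitmx_tr (rep_unit rhoT).
Qed.

Lemma fixedr_by_generators n k (rho : G -> 'M[C]_n) (v : 'M[C]_(k, n)) :
  tame_rep rho -> (forall i, I i -> v *m rho i = v) -> v *m rho Fr = v ->
  forall w, W w -> v *m rho w = v.
Proof.
move=> rhoT Iv Fv w Ww; have rhoT' := tame_contragredient rhoT.
have WVw := WV Ww.
have : contragredient rho (w^-1)%g *m v^T = v^T.
  apply: fixed_by_generators WVw => // [i Ii|].
    rewrite contragredientV //; last exact: IW.
    by rewrite -trmx_mul Iv //; exact: inertialV WI _ _.
  rewrite /contragredient -trmx_mul; congr _^T.
  by rewrite -[v in LHS]Fv mulmxK // (rep_unit rhoT).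
by rewrite contragredientV // invgK -trmx_mul => /trmx_inj.
Qed.

Lemma weil_fixed_spectrum n (rho : G -> 'M[C]_n) Q d b k (v : 'M[C]_(n, k)) :
  frob_spectrum rho Q d b -> (forall w, W w -> rho w *m v = v) ->
  coord_projector Q (fun i => b i && (d 0 i == 1)) *m v = v.
Proof.
move=> [Qu d0 FE il ir fl fr] vP.
pose c i := d 0 i == 1.
rewrite -(coord_projectorM b c Qu) -mulmxA -[RHS](fl _ v); last by move=> i /IW/vP.
congr (_ *m _); apply: (can_inj (mulKmx Qu)); apply/matrixP => i j.
rewrite coord_projectorE //.
have : (Q *m (rho Fr *m v)) i j = (Q *m v) i j by rewrite vP.
rewrite FE -!mulmxA mulKVmx // mul_diag_mx mxE => E.
case: (boolP (c i)) => [_|ci]; first by rewrite mul1r.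
rewrite mul0r; apply/eqP; rewrite eq_sym.
move/eqP: E; rewrite -subr_eq0 -{2}(mul1r ((Q *m v) i j)) -mulrBl mulf_eq0 subr_eq0.
by rewrite [d 0 i == 1](negbTE ci).
Qed.

(** A vector is W-invariant when it is fixed by inertia and by Frobenius, that is,
    when it is supported on the eigenvectors with b i and d i = 1. The statement
    on row vectors is the one on column vectors for the contragredient. *)
Lemma weil_projector_spectrum n (rho : G -> 'M[C]_n) Q d b :
  tame_rep rho -> frob_spectrum rho Q d b ->
  weil_projector rho (coord_projector Q (fun i => b i && (d 0 i == 1))).
Proof.
move=> rhoT spec; have [Qu d0 FE il ir fl fr] := spec.
pose c i := d 0 i == 1; 
have bc : coord_projector Q b *m coord_projector Q c = coord_projector Q (fun i => b i && c i).
  exact: coord_projectorM.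
have cb : coord_projector Q c *m coord_projector Q b = coord_projector Q (fun i => b i && c i).
  rewrite coord_projectorM // /coord_projector; congr (_ *m diag_mx _ *m _).
  by apply/rowP => i; rewrite !mxE andbC.
split.
- apply: fixed_by_generators => // [i Ii|]; first by rewrite -bc mulmxA il.
  rewrite FE /coord_projector -!mulmxA mulKVmx //; congr (_ *m _).
  rewrite mulmxA; congr (_ *m _); apply/matrixP => i j; rewrite mul_diag_mx !mxE.
  case: (i =P j) => _; rewrite ?mulr1n ?mulr0n ?mulr0 //.
  by case: (b i); case: (d 0 i =P 1) => [->|_]; rewrite ?mulr1 ?mulr0.
- apply: fixedr_by_generators => // [i Ii|]; first by rewrite -cb -mulmxA ir.
  rewrite FE /coord_projector -!mulmxA mulKVmx //; congr (_ *m _).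
  rewrite mulmxA; congr (_ *m _); apply/matrixP => i j; rewrite mul_diag_mx !mxE.
  case: (i =P j) => _; rewrite ?mulr1n ?mulr0n ?mulr0 //.
  by case: (b i); case: (d 0 i =P 1) => [->|_]; rewrite ?mulr1 ?mul0r.
- by move=> k v; apply: weil_fixed_spectrum.
move=> k v vP; apply: trmx_inj; rewrite trmx_mul coord_projector_tr.
have spec' := frob_spectrum_contragredient rhoT spec.
rewrite -[RHS](weil_fixed_spectrum spec' (v := v^T)) => [|w Ww].
  rewrite /coord_projector; congr (_ *m diag_mx _ *m _ *m _).
  by apply/rowP => i; rewrite !mxE invr_eq1.
by rewrite contragredientV // -trmx_mul vP //; exact: WV.
Qed.
End Representations.

(** * Complete reducibility and multiplicities *)

Section Semisimplicity.
Variables (C : numFieldType) (G : groupType) (W I : set G) (Fr : G).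
Hypothesis WI : inertial_group W I Fr.
Local Notation tame := (tame_rep W I Fr).
Local Notation hom rho1 rho2 X := (intertwines W rho1 rho2 X).
Local Notation projector := (weil_projector W).

Let W1 := weil1 WI.
Let WV := weilV WI.
Let WM := weilM WI.
Let WFr := weil_Fr WI.
Let IW := inertial_sub WI.

Lemma weil_projector_exists n (rho : G -> 'M[C]_n) : tame rho ->
  exists Pi, projector rho Pi.
Proof.
move=> rhoT; have [Q [d [b spec]]] := frob_spectrum_exists WI rhoT.
by eexists; apply: weil_projector_spectrum spec.
Qed.

(** X Pi1 has invariant columns and Pi2 X has invariant rows, hence both are equal
    to Pi2 X Pi1. *)
Lemma weil_projector_natural n1 n2 (rho1 : G -> 'M[C]_n1) (rho2 : G -> 'M[C]_n2) Pi1 Pi2 X :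
  projector rho1 Pi1 -> projector rho2 Pi2 -> hom rho1 rho2 X ->
  X *m Pi1 = Pi2 *m X.
Proof.
move=> [l1 r1 idl1 idr1] [l2 r2 idl2 idr2] h.
transitivity (Pi2 *m (X *m Pi1)).
  by rewrite idl2 // => w Ww; rewrite mulmxA h // -mulmxA l1.
by rewrite mulmxA idr1 // => w Ww; rewrite -mulmxA -h // mulmxA r2.
Qed.

Lemma weil_projector_unique n (rho : G -> 'M[C]_n) Pi Pi' :
  projector rho Pi -> projector rho Pi' -> Pi = Pi'.
Proof. by move=> [l r idl idr] [l' r' idl' idr']; rewrite -[LHS]idr' // idl. Qed.

Lemma weil_projector_idem n (rho : G -> 'M[C]_n) Pi : projector rho Pi -> Pi *m Pi = Pi.
Proof. by move=> [l r idl idr]; apply: idl. Qed.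

(** In characteristic 0 the trace of an idempotent determines its rank. *)
Lemma weil_projector_tr_eq0 n (rho : G -> 'M[C]_n) Pi : projector rho Pi ->
  (\tr Pi == 0) = (Pi == 0).
Proof.
move=> PiP; rewrite idempotent_trace ?(weil_projector_idem PiP) //.
by rewrite pnatr_eq0 mxrank_eq0.
Qed.

Lemma tensor1 m n : tensmx (1%:M : 'M[C]_m) (1%:M : 'M[C]_n) = 1%:M.
Proof.
apply/matrixP => i j; case: (mxtens_indexP i) => i1 i2; case: (mxtens_indexP j) => j1 j2.
rewrite tensmxE !mxE -natrM mulnb (inj_eq (can_inj (@mxtens_indexK m n))).
by rewrite xpair_eqE.
Qed.

Lemma diagonalizable_tens m n (A : 'M[C]_m) (B : 'M[C]_n) :
  diagonalizable A -> diagonalizable B -> diagonalizable (tensmx A B).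
Proof.
move=> /diagonalizable_conj[P Pu [a ->]] /diagonalizable_conj[Q Qu [b ->]].
have PQ : tensmx P Q *m tensmx (invmx P) (invmx Q) = 1%:M.
  by rewrite tensmx_mul !mulmxV // tensor1.
apply/diagonalizable_conj; exists (tensmx P Q); first by case: (mulmx1_unit PQ).
exists (\row_i (a 0 (mxtens_unindex i).1 * b 0 (mxtens_unindex i).2)).
rewrite (invmx_eq PQ) -!tensmx_mul; congr (_ *m _ *m _).
apply/matrixP => i j; case: (mxtens_indexP i) => i1 i2; case: (mxtens_indexP j) => j1 j2.
rewrite tensmxE !mxE !mxtens_indexK (inj_eq (can_inj (@mxtens_indexK m n))) xpair_eqE.
by do 2 case: eqP => _; rewrite ?mulr0n ?mulr1n ?mulr0 ?mul0r.
Qed.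

Lemma tame_tensor m n (rho1 : G -> 'M[C]_m) (rho2 : G -> 'M[C]_n) :
  tame rho1 -> tame rho2 -> tame (tensor rho1 rho2).
Proof.
move=> T1 T2; split.
- move=> w Ww; rewrite /tensor.
  suff /mulmx1_unit[] : tensmx (rho1 w) (rho2 w)
     *m tensmx (invmx (rho1 w)) (invmx (rho2 w)) = 1%:M by [].
  by rewrite tensmx_mul !mulmxV ?tensor1 ?(rep_unit T1) ?(rep_unit T2).
- by move=> v w Wv Ww; rewrite /tensor tensmx_mul (repM T1) ?(repM T2).
- have [s1 s1P] := rep_finite T1; have [s2 s2P] := rep_finite T2.
  exists [seq tensmx a b | a <- s1, b <- s2] => i Ii.
  by apply: (allpairs_f (fun a b => tensmx a b)); [apply: s1P | apply: s2P].
by apply: diagonalizable_tens; [apply: rep_diag T1 | apply: rep_diag T2].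
Qed.

Lemma tame_sub n m (phi : G -> 'M[C]_n) (tau : G -> 'M[C]_m) B P :
  tame phi -> P *m B = 1%:M -> hom tau phi B -> tame tau.
Proof.
move=> T PB h.
have tauE w : W w -> tau w = P *m phi w *m B.
  by move=> Ww; rewrite -mulmxA h // mulmxA PB mul1mx.
have tauM v w : W v -> W w -> tau (v * w)%g = tau v *m tau w.
  move=> Wv Ww; have VW := WM Wv Ww.
  rewrite tauE // (repM T) // -!mulmxA h // (mulmxA (phi v)) h // -mulmxA.
  by rewrite mulmxA PB mul1mx.
split=> //.
- move=> w Ww; have WVw := WV Ww.
  suff /mulmx1_unit[] : tau w *m tau (w^-1)%g = 1%:M by [].
  by rewrite -tauM // mulgV tauE // (rep1 WI T) mulmx1.
- have [s sP] := rep_finite T; exists [seq P *m g *m B | g <- s] => i Ii.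
  by rewrite tauE; [apply/map_f/sP | apply: IW].
apply: (diagonalizable_sub PB _ (rep_diag T)); exact: h.
Qed.

Lemma hom_tensor m n (tau : G -> 'M[C]_m) (phi : G -> 'M[C]_n) X :
  tame tau ->
  hom tau phi X <->
  (forall w, W w -> tensor (contragredient tau) phi w *m vec_hom X = vec_hom X).
Proof.
move=> T; split=> h w Ww; have Tu := rep_unit T Ww.
  by rewrite tensmx_vec h // mulmxK.
have := h w Ww; rewrite tensmx_vec => /(can_inj (@vec_homK _ _ _)) {2}<-.
by rewrite mulmxKV.
Qed.

(** The trace of Pi is the dimension of Hom_W(tau, phi), the W-invariants of
    tau^* (x) phi. Working with traces avoids choosing subspaces: additivity
    over direct sums is the cyclicity of the trace. *)
Definition same_multiplicity m n1 n2 (tau : G -> 'M[C]_m)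
    (phi1 : G -> 'M[C]_n1) (phi2 : G -> 'M[C]_n2) :=
  forall Pi1 Pi2, projector (tensor (contragredient tau) phi1) Pi1 ->
    projector (tensor (contragredient tau) phi2) Pi2 -> \tr Pi1 = \tr Pi2.

Lemma hom_neq0 m n (tau : G -> 'M[C]_m) (phi : G -> 'M[C]_n) Pi :
  tame tau -> projector (tensor (contragredient tau) phi) Pi ->
  \tr Pi != 0 <-> exists2 X, hom tau phi X & X != 0.
Proof.
move=> T PiP; rewrite (weil_projector_tr_eq0 PiP); split.
  move=> /matrix0Pn[i [j Pij]]; exists (hom_vec (col j Pi)).
    apply/hom_tensor => // w Ww; rewrite hom_vecK colE mulmxA.
    by rewrite (projl PiP).
  apply: contra Pij => /eqP/(congr1 (@vec_hom _ _ _)); rewrite hom_vecK.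
  by move=> /colP/(_ i); rewrite !mxE => ->.
move=> [X /(hom_tensor _ _ T) hX]; apply: contra => /eqP Pi0.
have := proj_idl PiP hX; rewrite Pi0 mul0mx => X0.
by rewrite -(vec_homK X) -X0; apply/eqP/matrixP => i j; rewrite !mxE.
Qed.

(** Applying the projector onto W-invariants of Hom(phi, tau) to any linear
    retraction P0 of B produces an intertwining P. It is still a retraction:
    X |-> X B is a map of representations from Hom(phi, tau) to End(tau), so
    by naturality P B is the projection of P0 B = 1, which is invariant. *)
Lemma complete_reducibility n m (phi : G -> 'M[C]_n) (tau : G -> 'M[C]_m) B P0 :
  tame phi -> P0 *m B = 1%:M -> hom tau phi B ->
  exists2 P, P *m B = 1%:M & hom phi tau P.
Proof.
move=> T P0B hB; have Tt := tame_sub T P0B hB.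
have Tc := tame_contragredient WI T; have Tct := tame_contragredient WI Tt.
have [Pi PiP] := weil_projector_exists (tame_tensor Tc Tt).
have [Pi' PiP'] := weil_projector_exists (tame_tensor Tct Tt).
pose P := hom_vec (Pi *m vec_hom P0).
have hP : hom phi tau P.
  by apply/hom_tensor => // w Ww; rewrite hom_vecK mulmxA (projl PiP).
exists P => //; apply: (can_inj (@vec_homK _ _ _)).
have vecB (X : 'M_(m, n)) : vec_hom (X *m B) = tensmx B^T 1%:M *m vec_hom X.
  by rewrite tensmx_vec mul1mx.
have hF : hom (tensor (contragredient phi) tau) (tensor (contragredient tau) tau)
    (tensmx B^T 1%:M).
  move=> w Ww; rewrite /tensor !tensmx_mul mulmx1 mul1mx /contragredient -!trmx_mul.
  congr (tensmx _^T _); apply: (can_inj (mulKmx (rep_unit T Ww))).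
  by rewrite mulmxA hB // mulmxK ?(rep_unit Tt) // mulmxA mulmxV ?mul1mx ?(rep_unit T).
rewrite vecB hom_vecK mulmxA (weil_projector_natural PiP PiP' hF) -mulmxA -vecB P0B.
apply: (proj_idl PiP'); apply/hom_tensor => // w Ww.
by rewrite mulmx1 mul1mx.
Qed.

(** phi is the direct sum of tau and sigma, given by inclusions B, D and
    projections P, Q. Using these four maps instead of block matrices avoids
    any cast between dimensions. *)
Record direct_sum n m k (phi : G -> 'M[C]_n) (tau : G -> 'M[C]_m) (sigma : G -> 'M[C]_k)
    (B : 'M_(n, m)) (P : 'M_(m, n)) (D : 'M_(n, k)) (Q : 'M_(k, n)) : Prop := DirectSum {
  ds_B : hom tau phi B; ds_P : hom phi tau P;
  ds_D : hom sigma phi D; ds_Q : hom phi sigma Q;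
  ds_PB : P *m B = 1%:M; ds_QD : Q *m D = 1%:M;
  ds_PD : P *m D = 0; ds_QB : Q *m B = 0;
  ds_1 : B *m P + D *m Q = 1%:M }.

(** sigma is the kernel of the equivariant retraction P, cut out by the idempotent
    1 - B P; its dimension drops because this idempotent kills the nonzero B. *)
Lemma split_sub n m (phi : G -> 'M[C]_n) (tau : G -> 'M[C]_m) B P0 :
  tame phi -> P0 *m B = 1%:M -> hom tau phi B -> (0 < m)%N ->
  exists k sigma P D Q, (k < n)%N /\ @direct_sum n m k phi tau sigma B P D Q.
Proof.
move=> T P0B hB m0; have [P PB hP] := complete_reducibility T P0B hB.
pose e := 1%:M - B *m P.
have eB : e *m B = 0 by rewrite mulmxBl mul1mx -mulmxA PB mulmx1 subrr.
have Pe : P *m e = 0 by rewrite mulmxBr mulmx1 mulmxA PB mul1mx subrr.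
have ee : e *m e = e.
  by rewrite {2}/e mulmxBr mulmx1 mulmxA eB mul0mx subr0.
have he w : W w -> phi w *m e = e *m phi w.
  move=> Ww; rewrite mulmxBr mulmxBl mulmx1 mul1mx.
  by rewrite (mulmxA (phi w)) hB // -!mulmxA hP.
have := idempotent_factor ee; move: (mulmx_base e).
have : (\rank e < n)%N.
  rewrite ltn_neqAle rank_leq_row andbT; apply/negP => eu.
  have {}eu : e \in unitmx by rewrite -row_free_unit.
  have B0 : B = 0 by rewrite -[B](mulKmx eu) eB mulmx0.
  move: PB; rewrite B0 mulmx0 => /matrixP/(_ (Ordinal m0) (Ordinal m0)).
  by rewrite !mxE eqxx => /esym/eqP; rewrite oner_eq0.
move: (col_base e) (row_base e); move: (\rank e) => k D Q ltkn DQ QD.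
have eD : e *m D = D by rewrite -DQ -mulmxA QD mulmx1.
have Qe : Q *m e = Q by rewrite -DQ mulmxA QD mul1mx.
exists k, (fun w => Q *m phi w *m D), P, D, Q; split=> //; split=> //.
- by move=> w Ww; rewrite !mulmxA DQ -he // -mulmxA eD.
- by move=> w Ww; rewrite -!mulmxA DQ he // (mulmxA Q) Qe.
- by rewrite -[D]mulmx1 -QD mulmxA DQ mulmxA Pe mul0mx.
- by rewrite -[Q]mul1mx -QD -mulmxA DQ -mulmxA eB mulmx0.
by rewrite DQ addrC subrK.
Qed.

Lemma hom_tens1 l n1 n2 (tau : G -> 'M[C]_l) (rho1 : G -> 'M[C]_n1)
    (rho2 : G -> 'M[C]_n2) X :
  hom rho1 rho2 X -> hom (tensor tau rho1) (tensor tau rho2) (tensmx 1%:M X).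
Proof. by move=> h w Ww; rewrite /tensor !tensmx_mul mulmx1 mul1mx h. Qed.

Lemma tensmxDr l n m (X Y : 'M[C]_(n, m)) :
  tensmx (1%:M : 'M_l) (X + Y) = tensmx 1%:M X + tensmx 1%:M Y.
Proof. by apply/matrixP => i j; rewrite !mxE mulrDr. Qed.

Lemma direct_sum_trace l n m k (rho : G -> 'M[C]_l) (phi : G -> 'M[C]_n)
    (tau : G -> 'M[C]_m) (sigma : G -> 'M[C]_k) B P D Q Pi Pi1 Pi2 :
  direct_sum phi tau sigma B P D Q ->
  projector (tensor rho phi) Pi -> projector (tensor rho tau) Pi1 ->
  projector (tensor rho sigma) Pi2 -> \tr Pi = \tr Pi1 + \tr Pi2.
Proof.
move=> S PiP Pi1P Pi2P; have [hB hP hD hQ PB QD PD QB one] := S.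
have nP := weil_projector_natural PiP Pi1P (hom_tens1 rho hP).
have nQ := weil_projector_natural PiP Pi2P (hom_tens1 rho hQ).
rewrite -[Pi]mul1mx -tensor1 -one tensmxDr mulmxDl mxtraceD.
have E a b (X : 'M[C]_(a, b)) (Y : 'M_(b, a)) :
    tensmx (1%:M : 'M_l) (X *m Y) = tensmx 1%:M X *m tensmx 1%:M Y.
  by rewrite tensmx_mul mulmx1.
rewrite !E -!mulmxA nP nQ; congr (_ + _).
  by rewrite mulmxA mxtrace_mulC !mulmxA -E PB tensor1 mul1mx.
by rewrite mulmxA mxtrace_mulC !mulmxA -E QD tensor1 mul1mx.
Qed.

(** Subrepresentations are described by a basis D of the subspace, with left
    inverse L, together with the induced representation sigma. *)
Definition irreducible_rep m (tau : G -> 'M[C]_m) :=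
  (0 < m)%N /\ forall d (sigma : G -> 'M[C]_d) D L,
    L *m D = 1%:M -> hom sigma tau D -> d = 0%N \/ d = m.

(** Half of Schur's lemma: the kernel of X is a subrepresentation. *)
Lemma irreducible_hom_inj m n (tau : G -> 'M[C]_m) (phi : G -> 'M[C]_n) X :
  irreducible_rep tau -> hom tau phi X -> X != 0 -> exists P, P *m X = 1%:M.
Proof.
move=> [m0 irr] hX X0; pose K := kermx X^T.
have [R RK] := row_freeP (row_base_free K).
have XK : X *m (row_base K)^T = 0.
  apply: trmx_inj; rewrite trmx_mul trmxK trmx0.
  by apply/sub_kermxP; rewrite eq_row_base.
have LD : R^T *m (row_base K)^T = 1%:M by rewrite -trmx_mul RK trmx1.
pose sigma w := R^T *m tau w *m (row_base K)^T.
have [|rK|rK] := irr _ sigma _ _ LD.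
- move=> w Ww; have : X *m (tau w *m (row_base K)^T) = 0.
    by rewrite mulmxA -hX // -mulmxA XK mulmx0.
  move=> /(congr1 trmx); rewrite trmx_mul trmx0 => /sub_kermxP sK.
  have /submxP[Z /(congr1 trmx)] : ((tau w *m (row_base K)^T)^T <= row_base K)%MS.
    by rewrite (eq_row_base K).
  rewrite trmxK [(Z *m _)^T]trmx_mul => E.
  by rewrite /sigma -(mulmxA R^T) E (mulmxA R^T) LD mul1mx.
- have /row_freeP[Y XY] : row_free X^T.
    by rewrite -kermx_eq0 -mxrank_eq0; apply/eqP.
  by exists Y^T; rewrite -[X]trmxK -trmx_mul XY trmx1.
move: rK X0; rewrite mxrank_ker mxrank_tr => rK; case/eqP; apply/eqP.
rewrite -mxrank_eq0 -leqn0 leqNgt; apply/negP => rX.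
have := ltn_subrL (\rank X) m; rewrite rK ltnn rX m0.
by [].
Qed.

Lemma sub_neq0 n m (B : 'M[C]_(n, m)) P : (0 < m)%N -> P *m B = 1%:M -> B != 0.
Proof.
move=> m0 PB; apply: contra_eq_neq PB => ->; rewrite mulmx0 eq_sym.
apply/eqP => /matrixP/(_ (Ordinal m0) (Ordinal m0))/eqP.
by rewrite !mxE eqxx oner_eq0.
Qed.

Variable param : forall n, (G -> 'M[C]_n) -> Prop.
Arguments param {n}.
Hypothesis param_tame : forall n (phi : G -> 'M[C]_n), param phi -> tame phi.
Hypothesis param_sub : forall n m (phi : G -> 'M[C]_n) (tau : G -> 'M[C]_m) B P,
  param phi -> P *m B = 1%:M -> hom tau phi B -> param tau.

(** A subrepresentation of minimal positive dimension is irreducible. *)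
Lemma irreducible_sub n (phi : G -> 'M[C]_n) : param phi -> (0 < n)%N ->
  exists m (tau : G -> 'M[C]_m) B P,
    [/\ param tau, irreducible_rep tau, P *m B = 1%:M & hom tau phi B].
Proof.
move=> phiP n0.
pose sub m := (0 < m)%N /\ exists (tau : G -> 'M[C]_m) B P,
  P *m B = 1%:M /\ hom tau phi B.
have ex : exists m, `[< sub m >].
  exists n; apply/asboolP; split=> //; exists phi, 1%:M, 1%:M; split; rewrite ?mulmx1 //.
  by move=> w _; rewrite mul1mx mulmx1.
case: (ex_minnP ex) => m /asboolP[m0 [tau [B [P [PB hB]]]]] mmin.
exists m, tau, B, P; split=> //; first exact: param_sub phiP PB hB.
split=> // d sigma D L LD hD; case: (posnP d) => [|d0]; [by left | right].
apply/eqP; rewrite eqn_leq (mulmx1_min LD) mmin //; apply/asboolP; split=> //.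
exists sigma, (B *m D), (L *m P); split; first by rewrite mulmxA -(mulmxA L) PB mulmx1 LD.
by move=> w Ww; rewrite mulmxA hB // -(mulmxA B) hD // mulmxA.
Qed.

(** An irreducible tau contained in phi1 has a nonzero Hom to phi2, so it is
    contained in both; split it off on both sides. Traces being additive, the
    complements have the same multiplicities, and the induction applies to them.
    The dimensions n1 and n2 are independent, so that their equality is part of
    the conclusion, and N bounds the irreducibles that occur all along. *)
Theorem iso_of_multiplicities N n1 n2 (phi1 : G -> 'M[C]_n1) (phi2 : G -> 'M[C]_n2) :
  param phi1 -> param phi2 -> (n1 <= N)%N -> (n2 <= N)%N ->
  (forall m (tau : G -> 'M[C]_m), (m <= N)%N -> param tau -> irreducible_rep tau ->
     same_multiplicity tau phi1 phi2) ->
  exists A A', [/\ A *m A' = 1%:M, A' *m A = 1%:M & hom phi1 phi2 A].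
Proof.
have [k] := ubnP n1; elim: k n1 n2 phi1 phi2 => // k IH n1 n2 phi1 phi2.
rewrite ltnS => n1k P1 P2 n1N n2N mult.
have T1 := param_tame P1; have T2 := param_tame P2.
have [n10|n1_gt0] := posnP n1.
  (* An irreducible part of phi2 would have a nonzero map to phi1 = 0. *)
  have [n20|n2_gt0] := posnP n2.
    move: phi1 phi2 {mult P1 P2 T1 T2}; rewrite n10 n20 => phi1 phi2.
    exists 0, 0; split; try by apply/matrixP => [[]].
    by move=> w _; apply/matrixP => [[]].
  have [m [tau [B [P [tauP irr PB hB]]]]] := irreducible_sub P2 n2_gt0.
  have Tt := param_tame tauP; have Tct := tame_contragredient WI Tt.
  have [Pi1 Pi1P] := weil_projector_exists (tame_tensor Tct T1).
  have [Pi2 Pi2P] := weil_projector_exists (tame_tensor Tct T2).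
  have mN : (m <= N)%N := leq_trans (mulmx1_min PB) n2N.
  have : \tr Pi1 != 0.
    rewrite (mult _ _ mN tauP irr _ _ Pi1P Pi2P); apply/(hom_neq0 Tt Pi2P).
    by exists B => //; apply: sub_neq0 PB; case: irr.
  move/(hom_neq0 Tt Pi1P) => [X _ /eqP[]].
  by apply/matrixP => i; have := ltn_ord i; rewrite [X in (_ < X)%N]n10.
have [m [tau [B1 [P01 [tauP irr PB1 hB1]]]]] := irreducible_sub P1 n1_gt0.
have Tt := param_tame tauP; have Tct := tame_contragredient WI Tt.
have m0 : (0 < m)%N by case: irr.
have mN : (m <= N)%N := leq_trans (mulmx1_min PB1) n1N.
have [X hX X0] : exists2 X, hom tau phi2 X & X != 0.
  have [Pi1 Pi1P] := weil_projector_exists (tame_tensor Tct T1).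
  have [Pi2 Pi2P] := weil_projector_exists (tame_tensor Tct T2).
  apply/(hom_neq0 Tt Pi2P); rewrite -(mult _ _ mN tauP irr _ _ Pi1P Pi2P).
  by apply/(hom_neq0 Tt Pi1P); exists B1 => //; apply: sub_neq0 PB1.
have [P02 PB2] := irreducible_hom_inj irr hX X0.
have [k1 [s1 [Q1 [D1 [R1 [k1n S1]]]]]] := split_sub T1 PB1 hB1 m0.
have [k2 [s2 [Q2 [D2 [R2 [k2n S2]]]]]] := split_sub T2 PB2 hX m0.
have s1P : param s1 := param_sub P1 (ds_QD S1) (ds_D S1).
have s2P : param s2 := param_sub P2 (ds_QD S2) (ds_D S2).
have [||||A [A' [AA' A'A hA]]] := IH k1 k2 s1 s2 _ s1P s2P.
- exact: leq_trans k1n n1k.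
- exact: leq_trans (ltnW k1n) n1N.
- exact: leq_trans (ltnW k2n) n2N.
- move=> l rho lN rhoP rirr E1 E2 E1P E2P.
  have Tr := tame_contragredient WI (param_tame rhoP).
  have [Pi1 Pi1P] := weil_projector_exists (tame_tensor Tr T1).
  have [Pi2 Pi2P] := weil_projector_exists (tame_tensor Tr T2).
  have [Pi0 Pi0P] := weil_projector_exists (tame_tensor Tr Tt).
  apply: (addrI (\tr Pi0)).
  rewrite -(direct_sum_trace S1 Pi1P Pi0P E1P) -(direct_sum_trace S2 Pi2P Pi0P E2P).
  exact: mult lN rhoP rirr _ _ Pi1P Pi2P.
have [hB hP hD hQ PB QD PD QB one] := S1.
have [hB' hP' hD' hQ' PB' QD' PD' QB' one'] := S2.
(* X identifies the copies of tau, and A the complements. *)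
exists (X *m Q1 + D2 *m A *m R1), (B1 *m Q2 + D1 *m A' *m R2); split.
- rewrite mulmxDl !mulmxDr !mulmxA.
  rewrite -(mulmxA X Q1 B1) PB mulmx1 -(mulmxA X Q1 D1) PD mulmx0 !mul0mx addr0.
  rewrite -(mulmxA _ R1 B1) QB mulmx0 mul0mx add0r.
  by rewrite -(mulmxA _ R1 D1) QD mulmx1 -(mulmxA D2) AA' mulmx1.
- rewrite mulmxDl !mulmxDr !mulmxA.
  rewrite -(mulmxA B1 Q2 X) PB' mulmx1 -(mulmxA B1 Q2 D2) PD' mulmx0 !mul0mx addr0.
  rewrite -(mulmxA _ R2 X) QB' mulmx0 mul0mx add0r.
  by rewrite -(mulmxA _ R2 D2) QD' mulmx1 -(mulmxA D1) A'A mulmx1.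
move=> w Ww; rewrite mulmxDr mulmxDl !mulmxA hB' // hD' // -!mulmxA.
by rewrite -hP // -hQ // !mulmxA -(mulmxA D2) hA // !mulmxA.
Qed.

End Semisimplicity.

(** * Divisors of rational functions *)

Section Divisors.
Variable C : numClosedFieldType.
Local Notation K := {fraction {poly C}}.
Local Notation tofrac := (@FracField.tofrac {poly C}).
Implicit Types (f g : K) (z : {a : C | a != 0}).

Lemma frac_repr f : f * tofrac \d_(repr f) = tofrac \n_(repr f).
Proof.
rewrite -{1}(reprK f); unlock FracField.tofrac; rewrite -[LHS]FracField.pi_mul.
apply/eqmodP; rewrite /= FracField.equivfE /FracField.mulf.
by rewrite !numden_Ratio ?mulf_neq0 ?oner_eq0 ?denom_ratioP // !mulr1 mulrC.
Qed.

(** The divisor is defined through the representative chosen by repr; it can be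
    computed from any other fraction representing f. *)
Lemma divisorE f p r z : p != 0 -> r != 0 -> f * tofrac r = tofrac p ->
  divisor f z = (mup (val z) p)%:Z - (mup (val z) r)%:Z.
Proof.
move=> p0 r0 fE; have d0 : \d_(repr f) != 0 := denom_ratioP _.
(* Cross-multiply the two fractions, and compare multiplicities. *)
have E : \n_(repr f) * r = p * \d_(repr f).
  apply/eqP; rewrite -tofrac_eq !rmorphM /= -fE -frac_repr mulrAC.
  by rewrite -!mulrA [X in f * X]mulrC.
have n0 : \n_(repr f) != 0.
  by apply: contra_eq_neq E => ->; rewrite mul0r eq_sym mulf_neq0.
have := congr1 (mup (val z)) E; rewrite !mupM // /divisor => {}E.
by apply/eqP; rewrite subr_eq addrAC eq_sym subr_eq -!PoszD E.
Qed.

Lemma divisorM f g z : f != 0 -> g != 0 -> divisor (f * g) z = divisor f z + divisor g z.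
Proof.
have num0 (h : K) : h != 0 -> \n_(repr h) != 0.
  apply: contra_neq => n0; have /eqP := frac_repr h; rewrite n0 rmorph0 mulf_eq0.
  by rewrite tofrac_eq0 (negbTE (denom_ratioP _)) orbF => /eqP.
move=> f0 g0; have [nf ng] := (num0 _ f0, num0 _ g0).
have df : \d_(repr f) != 0 := denom_ratioP _.
have dg : \d_(repr g) != 0 := denom_ratioP _.
rewrite (@divisorE _ (\n_(repr f) * \n_(repr g)) (\d_(repr f) * \d_(repr g))) ?mulf_neq0 //.
  by rewrite !mupM // /divisor !PoszD; ring.
by rewrite !rmorphM /= mulrACA !frac_repr.
Qed.

Lemma divisor_frac p z : p != 0 -> divisor (tofrac p) z = (mup (val z) p)%:Z.
Proof.
move=> p0; rewrite (@divisorE _ p 1) ?oner_eq0 //; last by rewrite rmorph1 mulr1.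
by rewrite [mup _ 1]mupNroot ?root1 // subr0.
Qed.

Lemma divisor_const (c : C) z : c != 0 -> divisor (ratC c) z = 0.
Proof.
by move=> c0; rewrite divisor_frac ?polyC_eq0 // mupNroot // rootC.
Qed.

Lemma divisor1 z : divisor (1 : K) z = 0.
Proof. by rewrite -(rmorph1 tofrac) divisor_frac ?oner_eq0 // mupNroot ?root1. Qed.

Lemma divisorV f z : f != 0 -> divisor f^-1 z = - divisor f z.
Proof.
move=> f0; have := divisorM z (invr_neq0 f0) f0.
by rewrite mulVf // divisor1 => /esym/eqP; rewrite addr_eq0 => /eqP.
Qed.

Lemma divisor_prod (J : eqType) (s : seq J) (F : J -> K) z : (forall i, F i != 0) ->
  divisor (\prod_(i <- s) F i) z = \sum_(i <- s) divisor (F i) z.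
Proof.
move=> F0; elim: s => [|i s IH].
  by rewrite !big_nil divisor1.
by rewrite !big_cons divisorM ?IH // prodf_seq_neq0; apply/allP => j _; apply: F0.
Qed.

Lemma ratX_neq0 : ratX C != 0.
Proof. by rewrite tofrac_eq0 polyX_eq0. Qed.

Lemma divisorX z : divisor (ratX C) z = 0.
Proof. by rewrite divisor_frac ?polyX_eq0 // mupNroot // rootX (valP z). Qed.

Lemma divisor_exp f (k : int) z : f != 0 -> divisor f z = 0 -> divisor (f ^ k) z = 0.
Proof.
move=> f0 fz; have E n : divisor (f ^+ n) z = 0.
  elim: n => [|n IH]; first by rewrite expr0 divisor1.
  by rewrite exprS divisorM ?expf_neq0 // IH fz.
case: k => n; first exact: E.
by rewrite NegzE -exprz_inv -exprnP exprVn divisorV ?expf_neq0 // E oppr0.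
Qed.

Lemma ratC_is_zmod_morphism : GRing.zmod_morphism (@ratC C).
Proof. by move=> x y; rewrite /ratC !rmorphB. Qed.
Lemma ratC_is_monoid_morphism : GRing.monoid_morphism (@ratC C).
Proof. by split=> [|x y]; rewrite /ratC ?rmorphM ?rmorph1. Qed.
HB.instance Definition _ :=
  GRing.isZmodMorphism.Build C K (@ratC C) ratC_is_zmod_morphism.
HB.instance Definition _ :=
  GRing.isMonoidMorphism.Build C K (@ratC C) ratC_is_monoid_morphism.

Lemma linear_fracE (c : C) : 1 - ratX C * ratC c = tofrac (1 - 'X * c%:P).
Proof. by rewrite rmorphB rmorphM rmorph1. Qed.

Lemma linear_neq0 (c : C) : 1 - ratX C * ratC c != 0.
Proof.
rewrite linear_fracE tofrac_eq0.
apply/eqP => /(congr1 (fun p : {poly C} => p.[0])).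
by rewrite !hornerE ?mul0r subr0 => /eqP; rewrite oner_eq0.
Qed.

Lemma divisor_linear (c : C) z : c != 0 ->
  divisor (1 - ratX C * ratC c) z = (c^-1 == val z).
Proof.
move=> c0; have E : 1 - 'X * c%:P = (- c)%:P * ('X - (c^-1)%:P).
  by rewrite polyCN mulNr mulrBr -polyCM mulfV // opprB mulrC.
rewrite linear_fracE E rmorphM -/(ratC (- c)).
rewrite divisorM ?divisor_const ?oppr_eq0 ?tofrac_eq0 ?polyXsubC_eq0 ?polyC_eq0 ?oppr_eq0 //.
by rewrite add0r divisor_frac ?polyXsubC_eq0 // (@mup_XsubCX _ 1); case: eqP.
Qed.

Lemma linearV_neq0 (c : C) : 1 - (ratX C)^-1 * ratC c != 0.
Proof.
have -> : 1 - (ratX C)^-1 * ratC c = (ratX C)^-1 * tofrac ('X - c%:P).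
  by rewrite rmorphB /= mulrBr mulVf ?ratX_neq0.
apply: mulf_neq0; first by rewrite invr_eq0 ratX_neq0.
by rewrite tofrac_eq0 polyXsubC_eq0.
Qed.

Lemma divisor_linearV (c : C) z :
  divisor (1 - (ratX C)^-1 * ratC c) z = (c == val z).
Proof.
have -> : 1 - (ratX C)^-1 * ratC c = (ratX C)^-1 * tofrac ('X - c%:P).
  by rewrite rmorphB /= mulrBr mulVf ?ratX_neq0.
rewrite divisorM; last first.
- by rewrite tofrac_eq0 polyXsubC_eq0.
- by rewrite invr_eq0 ratX_neq0.
rewrite divisorV ?ratX_neq0 // divisorX oppr0 add0r.
by rewrite divisor_frac ?polyXsubC_eq0 // (@mup_XsubCX _ 1); case: eqP.
Qed.

Lemma divisor_gamma_shape (c1 c2 u1 u2 f1 f2 f3 f4 : K) z :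
  c1 != 0 -> c2 != 0 -> u1 != 0 -> u2 != 0 ->
  f1 != 0 -> f2 != 0 -> f3 != 0 -> f4 != 0 ->
  divisor c1 z = 0 -> divisor c2 z = 0 -> divisor u1 z = 0 -> divisor u2 z = 0 ->
  divisor (c1 * u1 * f1^-1 * f2 * (c2 * u2 * f3^-1 * f4)) z
  = divisor f2 z + divisor f4 z - divisor f1 z - divisor f3 z.
Proof.
move=> c10 c20 u10 u20 f10 f20 f30 f40 c1z c2z u1z u2z.
have V1 := invr_neq0 f10; have V3 := invr_neq0 f30.
have m1 := mulf_neq0 c10 u10; have m2 := mulf_neq0 m1 V1; have m3 := mulf_neq0 m2 f20.
have n1 := mulf_neq0 c20 u20; have n2 := mulf_neq0 n1 V3; have n3 := mulf_neq0 n2 f40.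
rewrite (divisorM z m3 n3) (divisorM z m2 f20) (divisorM z m1 V1) (divisorM z c10 u10).
rewrite (divisorM z n2 f40) (divisorM z n1 V3) (divisorM z c20 u20).
rewrite (divisorV z f10) (divisorV z f30) c1z c2z u1z u2z.
move: (divisor f1 z) (divisor f2 z) (divisor f3 z) (divisor f4 z) => a b c d; clear; ring.
Qed.

(** On C^*, 1 - X c vanishes exactly at c^-1 and 1 - X^-1 c exactly at c, while
    constants and powers of X have no zero or pole. An eigenvalue d thus
    contributes zeros at d^-1 through both L(s) and L(-s) of the
    denominator, and poles at (q d)^-1 and q d^-1 through L(1-s) and L(1+s). *)
Lemma divisor_L_quotient (e1 e2 : C) (k1 k2 : int) (q : C) (ds : seq C) z :
  e1 != 0 -> e2 != 0 -> q != 0 -> all (fun d => d != 0) ds ->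
  let X := ratX C in
  let L (s : seq C) u := (\prod_(d <- s) (1 - u * ratC d))^-1 in
  let inv := [seq d^-1 | d <- ds] in
  let N y := (count_mem y inv)%:Z in
  divisor
   (ratC e1 * X ^ k1 * L inv ((ratC q)^-1 * X^-1) / L ds X
    * (ratC e2 * X^-1 ^ k2 * L ds ((ratC q)^-1 * X^-1^-1) / L inv X^-1)) z
  = N (val z) *+ 2 - N (val z * q) - N (val z / q).
Proof.
move=> e10 e20 q0 ds0 X L inv N.
have X0 : X != 0 := ratX_neq0.
have C0 c : c != 0 -> ratC c != 0 :> K by move=> c0; rewrite fmorph_eq0.
pose F1 (d : C) := 1 - X^-1 * ratC (q^-1 * d); pose F2 (d : C) := 1 - X * ratC d.
pose F3 (d : C) := 1 - X * ratC (q^-1 * d); pose F4 (d : C) := 1 - X^-1 * ratC d.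
have nz (F : C -> K) s : (forall d, F d != 0) -> \prod_(d <- s) F d != 0.
  by move=> F0; rewrite prodf_seq_neq0; apply/allP => j _; apply: F0.
have F10 d : F1 d != 0 by apply: linearV_neq0.
have F20 d : F2 d != 0 by apply: linear_neq0.
have F30 d : F3 d != 0 by apply: linear_neq0.
have F40 d : F4 d != 0 by apply: linearV_neq0.
have -> : L inv ((ratC q)^-1 * X^-1) = (\prod_(d <- inv) F1 d)^-1.
  by congr _^-1; apply: eq_bigr => d _; rewrite /F1 rmorphM fmorphV mulrCA mulrA.
have -> : L ds ((ratC q)^-1 * X^-1^-1) = (\prod_(d <- ds) F3 d)^-1.
  by congr _^-1; apply: eq_bigr => d _; rewrite /F3 invrK rmorphM fmorphV mulrCA mulrA.
rewrite -[L ds X]/((\prod_(d <- ds) F2 d)^-1) -[L inv X^-1]/((\prod_(d <- inv) F4 d)^-1).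
rewrite !invrK.
have n1 := nz _ inv F10; have n2 := nz _ ds F20.
have n3 := nz _ ds F30; have n4 := nz _ inv F40.
have m1 := C0 _ e10; have m2 := C0 _ e20.
have Y0 : X^-1 != 0 := invr_neq0 X0.
have Xz : divisor X z = 0 := divisorX z.
have Yz : divisor X^-1 z = 0 by rewrite (divisorV z X0) Xz oppr0.
rewrite (divisor_gamma_shape m1 m2 (expfz_neq0 k1 X0) (expfz_neq0 k2 Y0) n1 n2 n3 n4
  (divisor_const z e10) (divisor_const z e20) (divisor_exp k1 X0 Xz) (divisor_exp k2 Y0 Yz)).
rewrite (divisor_prod inv z F10) (divisor_prod ds z F20) (divisor_prod ds z F30) (divisor_prod inv z F40).
have cnt (P : pred C) s : \sum_(d <- s) (nat_of_bool (P d))%:Z = (count P s)%:Z.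
  by elim: s => [|d s IH]; rewrite ?big_nil // big_cons IH.
have E1 : \sum_(d <- inv) divisor (F1 d) z = N (val z * q).
  rewrite /N -cnt; apply: eq_bigr => d _; rewrite divisor_linearV; congr (nat_of_bool _)%:Z.
  by rewrite /= -(inj_eq (mulfI q0)) mulVKf // mulrC.
have E2 : \sum_(d <- ds) divisor (F2 d) z = N (val z).
  rewrite /N -cnt big_map; apply: eq_big_seq => d /(allP ds0) d0.
  by rewrite divisor_linear.
have E3 : \sum_(d <- ds) divisor (F3 d) z = N (val z / q).
  rewrite /N -cnt big_map; apply: eq_big_seq => d /(allP ds0) d0.
  rewrite divisor_linear ?mulf_neq0 ?invr_eq0 // invfM invrK /=; congr (nat_of_bool _)%:Z.
  by rewrite -[RHS](inj_eq (mulfI q0)) [q * (_ / q)]mulrCA mulfV ?mulr1.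
have E4 : \sum_(d <- inv) divisor (F4 d) z = N (val z).
  by rewrite /N -cnt; apply: eq_bigr => d _; rewrite divisor_linearV.
by rewrite E1 E2 E3 E4 mulr2n.
Qed.

(** As q > 1, the points z q^k are pairwise distinct. *)
Lemma finite_orbit_exit (s : seq C) (q : nat) (z : C) : (1 < q)%N -> z != 0 ->
  exists k0, forall k, (k0 <= k)%N -> z * q%:R ^+ k \notin s.
Proof.
move=> q1 z0; elim: s => [|x s [k0 IH]]; first by exists 0%N.
have [[k1 xk]|nx] := pselect (exists k, z * q%:R ^+ k = x).
  exists (maxn k0 k1.+1) => k; rewrite geq_max => /andP[kk0 kk1].
  rewrite inE negb_or IH // andbT -xk; apply: contraTneq kk1 => /(mulfI z0)/eqP.
  by rewrite -!natrX eqr_nat eqn_exp2l // => /eqP->; rewrite ltnn.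
exists k0 => k /IH; rewrite inE negb_or => ->; rewrite andbT.
by apply: contra_not_neq nx => <-; exists k.
Qed.

(** Along the orbit x q^k, the sequence f has zero second differences, so it is
    affine in k; as it vanishes for large k, it is zero. *)
Lemma second_difference_inj (f : C -> int) (s : seq C) (q : nat) :
  (1 < q)%N -> (forall x, x \notin s -> f x = 0) ->
  (forall x, x != 0 -> f x *+ 2 = f (x * q%:R) + f (x / q%:R)) ->
  forall x, x != 0 -> f x = 0.
Proof.
move=> q1 fs fq x x0; have q0 : q%:R != 0 :> C by rewrite pnatr_eq0 -lt0n ltnW.
pose g k := f (x * q%:R ^+ k).
have rec k : g k.+1 *+ 2 = g k.+2 + g k.
  rewrite /g fq; last by rewrite mulf_neq0 ?expf_neq0.
  by rewrite -!mulrA -exprSr [_ ^+ k.+1]exprSr -!mulrA mulfV ?mulr1.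
have lin k : g k = g 0%N + (g 1%N - g 0%N) *+ k.
  have [-> _] : g k = g 0%N + (g 1%N - g 0%N) *+ k /\ g k.+1 = g 0%N + (g 1%N - g 0%N) *+ k.+1.
    elim: k => [|k [IH1 IH2]]; first by rewrite mulr0n addr0 mulr1n addrC subrK.
    split=> //; have := rec k; rewrite IH1 IH2; move: (g 0%N) (g 1%N) (g k.+2) => a b c.
    rewrite !mulrS; move: ((b - a) *+ k) => u E.
    by rewrite -[LHS](addrK (a + u)) -E; ring.
  by [].
have [k0 k0P] := finite_orbit_exit s q1 x0.
have := fs _ (k0P k0 (leqnn _)); have := fs _ (k0P k0.+1 (leqnSn _)).
rewrite -/(g k0.+1) -/(g k0) [g k0.+1]lin [g k0]lin -[f x](_ : g 0%N = _); last first.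
  by rewrite /g expr0 mulr1.
by move: (g 0%N) (g 1%N) => a b; rewrite mulrSr => E1 E2; move: E1; rewrite addrA E2 add0r => d0;
   move: E2; rewrite d0 mul0rn addr0.
Qed.

End Divisors.

(** * Gamma divisors and the converse theorem *)

Section BasisMatrix.
Variables (C : fieldType) (n : nat) (U : {vspace 'cV[C]_n}).
Local Notation b := (vbasis U).

Definition basis_mx : 'M[C]_(n, \dim U) := \matrix_(i, j) tnth b j i 0.
Definition coord_mx : 'M[C]_(\dim U, n) := \matrix_(j, i) coord b j (delta_mx i 0).

Lemma coord_mxE k (v : 'M[C]_(n, k)) j l : (coord_mx *m v) j l = coord b j (col l v).
Proof.
rewrite mxE [col l v]matrix_sum_delta linear_sum; apply: eq_bigr => i _ /=.
by rewrite big_ord1 linearZ !mxE /= mulrC.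
Qed.

Lemma col_basis_mx j : col j basis_mx = tnth b j.
Proof. by apply/colP => i; rewrite !mxE. Qed.

Lemma coord_basis_mx : coord_mx *m basis_mx = 1%:M.
Proof.
apply/matrixP => i j; rewrite coord_mxE col_basis_mx (tnth_nth 0) coord_free ?mxE 1?eq_sym //.
exact: basis_free (vbasisP U).
Qed.

Lemma basis_coord_mx k (v : 'M[C]_(n, k)) :
  (forall l, col l v \in U) -> basis_mx *m (coord_mx *m v) = v.
Proof.
move=> vU; apply/matrixP => i l; rewrite [RHS](_ : _ = col l v i 0); last by rewrite mxE.
rewrite (coord_vbasis (vU l)) summxE mxE; apply: eq_bigr => j _.
by rewrite coord_mxE !mxE (tnth_nth 0) mulrC.
Qed.

End BasisMatrix.

Section WeilParameters.
Variables (p : nat) (p_pr : prime p) (F : fieldExtType (Qp p_pr)).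
Variables (Fbar : closedFieldType) (iota : {rmorphism F -> Fbar}).
Hypothesis Fbar_closure : algebraic_closure iota.
Variable q : nat.
Hypothesis q_card : residue_card iota q.
Variable Fr : gal_aut iota.
Hypothesis Fr_frob : geometric_frobenius q Fr.
Variable C : numClosedFieldType.
Local Notation gal := (gal_aut iota).
Local Notation W := (@weil _ _ _ _ iota q).
Local Notation I := (@inertia _ _ _ _ iota).
Local Notation tame := (tame_rep W I Fr).
Let WI : inertial_group W I Fr.
Proof. exact: weil_inertial. Qed.

Lemma parameter_tame n (phi : gal -> 'M[C]_n) : semisimple_parameter q phi -> tame phi.
Proof.
move=> phiP; have [phiU phiM _ phiD] := phiP; split=> //.
  exact: (open_kernel_finite_image Fr_frob Fbar_closure phiP).
exact/phiD/(weil_Fr WI).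
Qed.

Definition open_kernel n (phi : gal -> 'M[C]_n) := exists S : seq Fbar,
  forall i, I i -> (forall x, x \in S -> i x = x) -> phi i = 1%:M.

Lemma parameter_open_kernel n (phi : gal -> 'M[C]_n) :
  semisimple_parameter q phi -> open_kernel phi.
Proof.
move=> phiP; have T := parameter_tame phiP; have [_ _ [_ phiO] _] := phiP.
have [|S SP] := phiO 1%g; first by split; [exact: weil1 WI | exact: (rep1 WI T)].
by exists S => i Ii /(SP i Ii)[_]; rewrite mul1g.
Qed.

(** Openness of the kernel at 1 propagates to the other kernel elements by
    translation. *)
Lemma parameterP n (phi : gal -> 'M[C]_n) : tame phi -> open_kernel phi ->
  (forall w, W w -> diagonalizable (phi w)) -> semisimple_parameter q phi.
Proof.
move=> T [S SP] D; split=> //; [exact: rep_unit T | exact: repM T | split].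
  by move=> w [].
move=> w [Ww w1]; exists S => i Ii iS; have Wi := inertial_sub WI Ii.
by split; [exact: (weilM WI Ww Wi) | rewrite (repM T) // w1 mul1mx SP].
Qed.

Lemma parameter_sub n m (phi : gal -> 'M[C]_n) (tau : gal -> 'M[C]_m) B P :
  semisimple_parameter q phi -> P *m B = 1%:M -> intertwines W tau phi B ->
  semisimple_parameter q tau.
Proof.
move=> phiP PB h; have T := parameter_tame phiP.
apply: parameterP; first exact: (tame_sub WI T PB h).
  have [S SP] := parameter_open_kernel phiP; exists S => i Ii iS.
  rewrite -[LHS]mul1mx -PB -mulmxA -h ?SP ?mul1mx //; exact: (inertial_sub WI).
move=> w Ww; have [_ _ _ phiD] := phiP.
by apply: (diagonalizable_sub PB _ (phiD w Ww)); apply: h.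
Qed.

Lemma parameter_dual n (phi : gal -> 'M[C]_n) :
  semisimple_parameter q phi -> semisimple_parameter q (dual_rep phi).
Proof.
move=> phiP; have T := parameter_tame phiP.
apply: parameterP; first exact: (tame_contragredient WI T).
  have [S SP] := parameter_open_kernel phiP; exists S => i Ii iS.
  by rewrite /dual_rep SP // invmx1 trmx1.
move=> w Ww; rewrite [dual_rep phi w](contragredientV WI T Ww).
by apply/diagonalizable_tr; have [_ _ _] := phiP; apply; exact: (weilV WI Ww).
Qed.

Lemma parameter_tensor m n (tau : gal -> 'M[C]_m) (phi : gal -> 'M[C]_n) :
  semisimple_parameter q tau -> semisimple_parameter q phi ->
  semisimple_parameter q (tensor_rep tau phi).
Proof.
move=> tauP phiP; have T := parameter_tame phiP; have Tt := parameter_tame tauP.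
apply: parameterP; first exact: (tame_tensor Tt T).
  have [S SP] := parameter_open_kernel phiP; have [S' SP'] := parameter_open_kernel tauP.
  exists (S ++ S') => i Ii iS; rewrite /tensor_rep SP ?SP' ?tensor1 // => x xS.
    by apply: iS; rewrite mem_cat xS orbT.
  by apply: iS; rewrite mem_cat xS.
move=> w Ww; have [_ _ _ D] := phiP; have [_ _ _ Dt] := tauP.
by apply: diagonalizable_tens; [apply: Dt | apply: D].
Qed.

Lemma irreducible_repP m (tau : gal -> 'M[C]_m) :
  irreducible_rep W tau -> irreducible_parameter q tau.
Proof.
move=> [m0 irr]; split=> // U stab.
have [|dU|dU] := irr _ (fun w => coord_mx U *m (tau w *m basis_mx U)) _ _ (coord_basis_mx U).
- move=> w Ww; rewrite basis_coord_mx // => l.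
  by rewrite colE -mulmxA -colE; apply: stab => //; rewrite col_basis_mx vbasis_mem ?mem_tnth.
- by left; apply/eqP; rewrite -dimv_eq0 dU.
right; apply/eqP; rewrite eqEdim subvf dimvf /dim /=.
by rewrite dU muln1.
Qed.

Lemma inertia_invariantsP n (rho : gal -> 'M[C]_n) v :
  v \in inertia_invariants rho <-> forall i, I i -> rho i *m v = v.
Proof. by rewrite /inertia_invariants; case: (cid _) => U UP; apply: UP. Qed.

(** The eigenvalues of Frobenius on the inertia invariants, with multiplicity. *)
Definition spectrum n (d : 'rV[C]_n) (b : 'I_n -> bool) : seq C :=
  [seq d 0 i | i <- enum 'I_n & b i].

(** Inertia being normal, Frobenius preserves the inertia invariants, so its matrix
    in the basis vbasis satisfies the hypotheses of frob_spectrum_det. *)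
Lemma L_factorE n (rho : gal -> 'M[C]_n) Q d b u : tame rho ->
  frob_spectrum I Fr rho Q d b ->
  L_factor Fr rho u = (\prod_(a <- spectrum d b) (1 - u * ratC a))^-1.
Proof.
move=> T spec; congr _^-1; set U := inertia_invariants rho.
have M_E : frobenius_on_invariants Fr rho = coord_mx U *m (rho Fr *m basis_mx U).
  apply/matrixP => i j; rewrite coord_mxE mxE colE -mulmxA -colE col_basis_mx //.
rewrite (frob_spectrum_det (ratC (C := C)) u spec (coord_basis_mx U)).
- by rewrite big_map big_filter big_enum_cond.
- move=> i Ii; apply/matrixP => a j.
  have /inertia_invariantsP/(_ i Ii) : col j (basis_mx U) \in U.
    by rewrite col_basis_mx vbasis_mem ?mem_tnth.
  by rewrite colE mulmxA -colE -colE => /colP/(_ a); rewrite !mxE.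
- move=> v /inertia_invariantsP vU; exists (coord_mx U *m v).
  by rewrite basis_coord_mx // => l; rewrite ord1 (_ : col 0 v = v) //; apply/colP => i; rewrite mxE.
rewrite M_E basis_coord_mx // => l; apply/inertia_invariantsP => i Ii.
have Wi := inertial_sub WI Ii; have WFr := weil_Fr WI.
have IiF : I (i ^ Fr)%g := inertialJ WI Fr Ii.
rewrite colE -mulmxA -colE mulmxA -(repM T) // conjgC (repM T) //; last exact: (inertial_sub WI IiF).
rewrite -mulmxA; congr (_ *m _); have /inertia_invariantsP/(_ _ IiF) // : col l (basis_mx U) \in U.
by rewrite col_basis_mx vbasis_mem ?mem_tnth.
Qed.

Lemma frob_spectrum_ext n (rho rho' : gal -> 'M[C]_n) Q d b :
  (forall w, W w -> rho w = rho' w) ->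
  frob_spectrum I Fr rho Q d b -> frob_spectrum I Fr rho' Q d b.
Proof.
move=> E [Qu d0 FE il ir fl fr]; have EI i : I i -> rho i = rho' i.
  by move=> Ii; apply/E/(inertial_sub WI).
split=> //.
- by rewrite -E //; apply: weil_Fr WI.
- by move=> i Ii; rewrite -EI // il.
- by move=> i Ii; rewrite -EI // ir.
- by move=> k v vP; apply: fl => i Ii; rewrite EI // vP.
by move=> k v vP; apply: fr => i Ii; rewrite EI // vP.
Qed.

Lemma spectrum_inv n (d : 'rV[C]_n) b :
  spectrum (\row_i (d 0 i)^-1) b = [seq x^-1 | x <- spectrum d b].
Proof. by rewrite -map_comp; apply: eq_map => i /=; rewrite mxE. Qed.

Lemma spectrum_trace n (Q : 'M[C]_n) (d : 'rV[C]_n) b : Q \in unitmx ->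
  \tr (coord_projector Q (fun i => b i && (d 0 i == 1)))
  = (count_mem 1 [seq x^-1 | x <- spectrum d b])%:R.
Proof.
move=> Qu; rewrite coord_projector_trace //; congr _%:R.
rewrite !count_map count_filter -sum1_count big_enum_cond /= [RHS]big_mkcond /=.
apply: eq_bigr => i _; rewrite invr_eq1 andbC.
by case: (_ && _).
Qed.

Lemma additive_character_conj (psi : F -> C) :
  additive_character iota psi -> additive_character iota (fun x => (psi x)^*).
Proof.
move=> [psiD psi1 [k psik] [x psix]]; split.
- by move=> y z; rewrite psiD rmorphM.
- by move=> y; rewrite norm_conjC.
- by exists k => y yO; rewrite psik // rmorph1.
by exists x; rewrite -(rmorph1 Num.conj) (inj_eq (can_inj conjCK)).
Qed.

(** The four representations in Gamma are tau^* (x) phi, its dual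
    tau (x) phi^*, and the duals of these two; on the Weil group they only
    have the spectrum of tau^* (x) phi and the inverse spectrum. *)
Lemma Gamma_spectrum (eps : epsilon_system iota C) psi m n
    (tau : gal -> 'M[C]_m) (phi : gal -> 'M[C]_n) Q d b a :
  monomial_epsilon q eps -> additive_character iota psi ->
  semisimple_parameter q tau -> semisimple_parameter q phi ->
  frob_spectrum I Fr (tensor_rep (dual_rep tau) phi) Q d b ->
  let N y := (count_mem y [seq x^-1 | x <- spectrum d b])%:Z in
  Gamma q Fr eps psi tau phi a
  = N (val a) *+ 2 - N (val a * q%:R) - N (val a / q%:R).
Proof.
move=> eps0 psiC tauP phiP spec N.
have rho1P := parameter_tensor (parameter_dual tauP) phiP.
have rho2P := parameter_tensor tauP (parameter_dual phiP).
have T1 := parameter_tame rho1P; have T2 := parameter_tame rho2P.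
have spec' := frob_spectrum_contragredient WI T1 spec.
have UV w : W w -> tau w \in unitmx /\ phi w \in unitmx.
  by move=> Ww; have [tU _ _ _] := tauP; have [pU _ _ _] := phiP; split; [apply: tU | apply: pU].
have invt w : W w -> invmx (tensmx (invmx (tau w))^T (phi w))
    = tensmx (tau w)^T (invmx (phi w)).
  move=> /UV[tU pU]; apply: invmx_eq.
  by rewrite tensmx_mul -trmx_mul !mulmxV // trmx1 tensor1.
have invt' w : W w -> invmx (tensmx (tau w) (invmx (phi w))^T)
    = tensmx (invmx (tau w)) (phi w)^T.
  move=> /UV[tU pU]; apply: invmx_eq.
  by rewrite tensmx_mul -trmx_mul !mulmxV // trmx1 tensor1.
have spec2 : frob_spectrum I Fr (tensor_rep tau (dual_rep phi)) (invmx Q)^T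
    (\row_i (d 0 i)^-1) b.
  apply: frob_spectrum_ext spec' => w Ww.
  by rewrite /contragredient /tensor_rep /dual_rep invt // trmx_tens trmxK.
have spec2' : frob_spectrum I Fr (dual_rep (tensor_rep tau (dual_rep phi))) Q d b.
  apply: frob_spectrum_ext spec => w Ww.
  by rewrite /tensor_rep /dual_rep invt' // trmx_tens trmxK.
rewrite /Gamma /gamma_factor.
rewrite (L_factorE _ (parameter_tame (parameter_dual rho1P)) spec').
rewrite (L_factorE _ T1 spec) (L_factorE _ T2 spec2).
rewrite (L_factorE _ (parameter_tame (parameter_dual rho2P)) spec2').
rewrite !spectrum_inv.
have [d0 q0] : all (fun x => x != 0) (spectrum d b) /\ q%:R != 0 :> C.
  split; first by apply/allP => _ /mapP[i _ ->]; apply: spec_neq0 spec i.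
  by rewrite pnatr_eq0 -lt0n ltnW // (residue_card_gt1 q_card).
have e1 := eps0 psi _ _ psiC rho1P.
have e2 := eps0 _ _ _ (additive_character_conj psiC) rho2P.
exact: (divisor_L_quotient _ _ a e1 e2 q0 d0).
Qed.

(** By Gamma_spectrum the divisor is minus a second difference, along multiplication
    by q, of the multiplicity function N of the inverse Frobenius eigenvalues.
    This determines N by second_difference_inj, and N 1 is the dimension of
    Hom_W(tau, phi). *)
Lemma Gamma_multiplicity (eps : epsilon_system iota C) psi m n1 n2
    (tau : gal -> 'M[C]_m) (phi1 : gal -> 'M[C]_n1) (phi2 : gal -> 'M[C]_n2) :
  monomial_epsilon q eps -> additive_character iota psi ->
  semisimple_parameter q tau -> semisimple_parameter q phi1 ->
  semisimple_parameter q phi2 ->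
  Gamma q Fr eps psi tau phi1 = Gamma q Fr eps psi tau phi2 ->
  same_multiplicity W tau phi1 phi2.
Proof.
move=> eps0 psiC tauP phi1P phi2P GE Pi1 Pi2 Pi1P Pi2P.
have T1 := parameter_tame (parameter_tensor (parameter_dual tauP) phi1P).
have T2 := parameter_tame (parameter_tensor (parameter_dual tauP) phi2P).
have [Q1 [d1 [b1 spec1]]] := frob_spectrum_exists WI T1.
have [Q2 [d2 [b2 spec2]]] := frob_spectrum_exists WI T2.
rewrite (weil_projector_unique Pi1P (weil_projector_spectrum WI T1 spec1)).
rewrite (weil_projector_unique Pi2P (weil_projector_spectrum WI T2 spec2)).
rewrite (spectrum_trace _ _ (spec_unit spec1)) (spectrum_trace _ _ (spec_unit spec2)).
set s1 := [seq _ | x <- spectrum d1 b1]; set s2 := [seq _ | x <- spectrum d2 b2].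
pose f x : int := (count_mem x s1)%:Z - (count_mem x s2)%:Z.
suff : f 1 = 0 by move=> /eqP; rewrite subr_eq0 eqz_nat => /eqP->.
apply: (second_difference_inj (s := s1 ++ s2) (residue_card_gt1 q_card)).
- move=> x; rewrite mem_cat negb_or => /andP[x1 x2].
  by rewrite /f (count_memPn x1) (count_memPn x2) subrr.
- move=> x x0; have := congr1 (fun D => D (exist _ x x0)) GE.
  rewrite (Gamma_spectrum _ eps0 psiC tauP phi1P spec1).
  rewrite (Gamma_spectrum _ eps0 psiC tauP phi2P spec2) /= -/s1 -/s2 /f.
  move: (count_mem x s1)%:Z (count_mem x s2)%:Z => A1 A2.
  move: (count_mem (x * _) s1)%:Z (count_mem (x * _) s2)%:Z => B1 B2.
  move: (count_mem (x / _) s1)%:Z (count_mem (x / _) s2)%:Z => D1 D2 E.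
  have : A1 *+ 2 - B1 - D1 - (A2 *+ 2 - B2 - D2) = 0 by rewrite E subrr.
  move=> {}E; apply/eqP; rewrite -subr_eq0 -[X in _ == X]E; apply/eqP; ring.
exact: oner_neq0.
Qed.

Theorem Gamma_converse (eps : epsilon_system iota C) psi n (phi1 phi2 : gal -> 'M[C]_n) :
  monomial_epsilon q eps -> additive_character iota psi ->
  semisimple_parameter q phi1 -> semisimple_parameter q phi2 ->
  (forall m (tau : gal -> 'M[C]_m), (m <= n)%N -> semisimple_parameter q tau ->
     irreducible_parameter q tau ->
     Gamma q Fr eps psi tau phi1 = Gamma q Fr eps psi tau phi2) ->
  isomorphic_rep q phi1 phi2.
Proof.
move=> eps0 psiC P1 P2 GE.
have [||m tau mn tauP irr|A [A' [AA' _ hA]]] :=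
  iso_of_multiplicities WI (N := n) (@parameter_tame) (@parameter_sub) P1 P2.
- by [].
- by [].
- apply: (Gamma_multiplicity eps0 psiC) => //.
  by apply: GE => //; apply: irreducible_repP.
exists A; first by case: (mulmx1_unit AA').
by move=> w Ww; rewrite hA.
Qed.
End WeilParameters.

Theorem proposition7p7
  (R : realType) (p : nat) (p_pr : prime p) (F : fieldExtType (Qp p_pr))
  (Fbar : closedFieldType) (iota : {rmorphism F -> Fbar})
  (Fbar_closure : algebraic_closure iota)
  (q : nat) (q_card : residue_card iota q)
  (Fr : gal_aut iota) (Fr_frob : geometric_frobenius q Fr)
  (psi : F -> R[i]) (psi_char : additive_character iota psi)
  (epsilon : epsilon_system iota R[i])
  (epsilon_monomial : monomial_epsilon q epsilon)
  (n : nat) (phi1 phi2 : gal_aut iota -> 'M[R[i]]_n)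
  (phi1_param : semisimple_parameter q phi1)
  (phi2_param : semisimple_parameter q phi2) :
  (forall (m : nat) (tau : gal_aut iota -> 'M[R[i]]_m),
     (m <= n)%N -> semisimple_parameter q tau -> irreducible_parameter q tau ->
     Gamma q Fr epsilon psi tau phi1 = Gamma q Fr epsilon psi tau phi2) ->
  isomorphic_rep q phi1 phi2.
Proof.
by have := @Gamma_converse _ p_pr F Fbar iota Fbar_closure q q_card Fr Fr_frob (R[i] : numClosedFieldType)
  epsilon psi n phi1 phi2 epsilon_monomial psi_char phi1_param phi2_param; apply.
Qed.
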